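(* The quasiparabolic Gelfand models of $H_3$ are exactly the four families \[ \{A,\omega B\},\qquad \{\omega A,B\},\qquad \{C,\mathbf 1,\omega\},\qquad \{C,\mathbf 1+\omega\}, \] where the joined linear term $\mathbf 1+\omega$ is $\mathrm{Ind}_{\ker\omega}^W\mathbf 1$.
   Context: $W=H_3$ has simple generators $s,t,u$ with $m_{st}=5$, $m_{tu}=3$, $m_{su}=2$; $\omega=\mathrm{sgn}_W$, $\omega(w)=(-1)^{\ell(w)}$. Put $A=\mathrm{Ind}_{\langle s,t\rangle}^W\mathbf 1$, $B=\mathrm{Ind}_{\langle t,u\rangle}^W\mathbf 1$, and $C=\mathrm{Ind}_{\langle s,u\rangle}^W\alpha$, where $\alpha(s)=1$, $\alpha(u)=-1$. For a finite Coxeter system $(W,S)$ with length $\ell$, reflections $T=\{wsw^{-1}\}$, $W_J=\langle J\rangle$: a scaled $W$-set is a $W$-set $X$ with $h:X\to\mathbb Z$ such that $|h(sx)-h(x)|\le 1$ for $s\in S$. It is quasiparabolic (QP) if for all $x\in X$, $r\in T$, $s\in S$: (QP1) $h(rx)=h(x)$ implies $rx=x$; (QP2) $h(rx)>h(x)$ and $h(srx)<h(sx)$ imply $rx=sx$. A subgroup $H\le W_J$ is quasiparabolic if $W_J/H$ with $h(wH)=\min_{u\in wH}\ell(u)$ is quasiparabolic for $(W_J,J)$. An allowed character is $\mathrm{Ind}_H^W(\sigma|_H)$ with $J\subseteq S$, $H\le W_J$ quasiparabolic, $\sigma$ a one-dimensional complex character of $W_J$. A quasiparabolic Gelfand model is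 an unordered family (multiset) of allowed characters with sum $\Gamma_W=\sum_{\rho\in\mathrm{Irr}(W)}\rho$; families are identified if their individual induced characters agree after reordering. *)

(* Defs.v *)
From HB Require Import structures.
From mathcomp Require Import all_boot all_order all_fingroup all_algebra.
From mathcomp Require Import all_solvable all_field all_character.

Set Implicit Arguments.
Unset Strict Implicit.
Unset Printing Implicit Defensive.

Import Order.TTheory GroupScope GRing.Theory Num.Theory.
Local Open Scope group_scope.

(* [m(x, y)] is taken to be the order of [x * y], as in Bourbaki; the last     *)
(* clause is the universal property of the group presented by the relations    *)
(* [(x y)^m(x, y) = 1], tested against arbitrary (also infinite) groups.       *)
Definition coxeter_system (gT : finGroupType) (W : {group gT}) (S : {set gT}) :
    Prop :=
  [/\ W :=: <<S>>,
      {in S, forall x, #[x] = 2%N}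
    & forall (rT : groupType) (f : gT -> rT),
        {in S &, forall x y, (f x * f y) ^+ #[x * y] = 1} ->
        exists phi : gT -> rT,
          {in W &, {morph phi : x y / x * y}} /\ {in S, phi =1 f}].

(* [S ^+ n] is the set of products of [n] elements of [S].  Every [w] in       *)
(* [<<S>>] is such a product for some [n < #|gT|], so the default value is     *)
(* never attained there.                                                       *)
Definition cox_length (gT : finGroupType) (S : {set gT}) (w : gT) : nat :=
  \big[minn/#|gT|]_(n < #|gT| | w \in S ^+ n) n.

Definition reflections (gT : finGroupType) (W : {group gT}) (S : {set gT}) :
    {set gT} :=
  class_support S W.

(* MathComp's [action] is a right action, hence this left-handed version; the  *)
(* underlying [W]-set is the part [X] of the type [xT].                        *)
Definition is_left_action (gT : finGroupType) (W : {group gT}) (xT : Type)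
    (X : {pred xT}) (act : gT -> xT -> xT) : Prop :=
  [/\ {in W & X, forall w x, act w x \in X},
      {in X, forall x, act 1 x = x}
    & {in W & W & X, forall v w x, act (v * w) x = act v (act w x)}].

Definition scaled_set (gT : finGroupType) (W : {group gT}) (S : {set gT})
    (xT : Type) (X : {pred xT}) (act : gT -> xT -> xT) (h : xT -> int) : Prop :=
  is_left_action W X act /\
  {in S & X, forall s x, (`|h (act s x) - h x| <= 1)%R}.

Definition quasiparabolic_set (gT : finGroupType) (W : {group gT})
    (S : {set gT}) (xT : Type) (X : {pred xT}) (act : gT -> xT -> xT)
    (h : xT -> int) : Prop :=
  [/\ scaled_set W S X act h,
      {in X & reflections W S, forall x r,
         h (act r x) = h x -> act r x = x}
    & {in X & reflections W S & S, forall x r s,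
         (h x < h (act r x))%R ->
         (h (act s (act r x)) < h (act s x))%R ->
         act r x = act s x}].

(* The default [#|gT|] bounds [cox_length S] from above, so this is the true   *)
(* minimum on a nonempty set.                                                  *)
Definition min_length (gT : finGroupType) (S A : {set gT}) : nat :=
  \big[minn/#|gT|]_(w in A) cox_length S w.

(* The length of [(W, S)] restricts to the length of [(W_J, J)] on [<<J>>].    *)
Definition quasiparabolic_subgroup (gT : finGroupType) (S J : {set gT})
    (H : {group gT}) : Prop :=
  H \subset <<J>> /\
  quasiparabolic_set <<J>>%G J (lcosets H <<J>>) (fun w A => w *: A)
    (fun A => Posz (min_length S A)).

Definition allowed_character (gT : finGroupType) (W : {group gT})
    (S : {set gT}) (chi : 'CF(W)) : Prop :=
  exists (J : {set gT}) (H : {group gT}) (sigma : 'CF(<<J>>)),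
    [/\ J \subset S,
        quasiparabolic_subgroup S J H,
        sigma \is a linear_char
      & chi = ('Ind[W] ('Res[H] sigma))%R].

(* A multiset is represented by a sequence; [perm_eq] identifies families.     *)
Definition qp_gelfand_model (gT : finGroupType) (W : {group gT})
    (S : {set gT}) (F : seq 'CF(W)) : Prop :=
  {in F, forall chi, allowed_character S chi} /\
  (\sum_(chi <- F) chi = \sum_i 'chi[W]_i)%R.

(* Main.v *)
(* Write Gamma for the sum of the irreducible characters, N = ker omega, and   *)
(* w0 = (s t u)^5 for the central (odd) longest element.  The twelve cosets of *)
(* <s, t> give |W| = 120 and a faithful permutation action which decides       *)
(* equality of words; this yields the few centraliser orders that are needed.  *)
(*   Gamma = C + 1 + omega: an irreducible chi with '[chi, C] = 0 satisfies    *)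
(* chi 1 = chi (s u), so it identifies s with u, hence all generators, and is  *)
(* linear.  Thus every irreducible occurs in C + 1 + omega, which has norm 10, *)
(* and there are at least 10 classes.  Comparing values on class               *)
(* representatives also gives Gamma = A + omega B, so Gamma vanishes on odd    *)
(* elements and on even involutions.                                           *)
(*   An allowed character of degree at most 32 is either C or xi Ind_H 1 with  *)
(* xi = 1 or omega.  If C occurs in a model, the other terms sum to 1 + omega. *)
(* Otherwise all terms are nonnegative on N, so no H contains an even          *)
(* involution; each term contains 1 or omega, so there are two terms, neither  *)
(* H lies in N, and the degrees must be 12 and 20.  As Gamma w0 = 0, w0 lies   *)
(* in neither H, which leaves only the conjugates of <s, t> and <t, u>.        *)

Require Import Defs.
From HB Require Import structures.
From mathcomp Require Import all_boot all_order all_fingroup all_algebra.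
From mathcomp Require Import all_solvable all_field all_character.

Set Implicit Arguments.
Unset Strict Implicit.
Unset Printing Implicit Defensive.

Import Order.TTheory GroupScope GRing.Theory Num.Theory.
Local Open Scope ring_scope.
Local Open Scope group_scope.

(** Two expressions of Gamma carry the result: C + 1 + omega ([GammaE]) and A + omega B ([GammaAB]).
    They exhibit the first, third and fourth families, the last one because inducing 1 from the even
    subgroup N gives 1 + omega ([Ind_ker]); the second family is the first multiplied by omega,
    which fixes Gamma. Admissibility of the terms comes from [qp_parabolic] and [qp_ker].

    For the converse, each term has degree at most 32, hence is induced from a subgroup H of order
    at least 4, and [allowed_cases] leaves C and the products of some Ind_H 1 with 1 or omega. Once
    C is removed, the rest has degree 2 and is settled by [sum_1_omega]. Without C, Frobenius
    reciprocity puts 1 or omega into every term, while Gamma contains each of them once; so there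
    are at most two terms. One term would have degree 32, which does not divide 120; two terms must
    carry different linear characters. [Ind1_pair] then finds the two subgroups from the degrees and
    from the zeros of Gamma, and [dihedral_subgroup] identifies them up to conjugacy by Sylow's
    theorem.

    The facts about W itself are computed. [coset_rep_step] bounds the order of W by 120,
    [uniq_word_act] shows that the action on twelve cosets separates 120 words, and [ev_eq] thereby
    turns equality in W into equality of lists. *)

Lemma uniq_map_inj (T1 T2 : eqType) (f : T1 -> T2) (r : seq T1) :
  uniq (map f r) -> {in r &, injective f}.
Proof.
elim: r => //= a r IHr /andP[/negP nfa /IHr injf] x y.
rewrite !inE => /orP[/eqP-> | rx] /orP[/eqP-> | ry] // eqf; last exact: injf.
  by case: nfa; rewrite eqf map_f.
by case: nfa; rewrite -eqf map_f.
Qed.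

(** * Words in the generators and their action on twelve cosets *)

Section Words.

Variable gT : groupType.
Implicit Types (x : nat -> gT) (v w : seq nat).

Definition word_val x w : gT := \prod_(i <- w) x i.

Lemma word_val_cat x v w : word_val x (v ++ w) = word_val x v * word_val x w.
Proof. exact: big_cat. Qed.

Lemma word_val_nseq x n w :
  word_val x (flatten (nseq n w)) = word_val x w ^+ n.
Proof.
elim: n => [|n IHn]; first by rewrite expg0 [LHS]big_nil.
by rewrite /= word_val_cat IHn expgS.
Qed.

End Words.

(* Right multiplication by s, t, u on the twelve right cosets of <s, t>, with  *)
(* representatives [coset_rep].                                                *)
Definition coset_step : seq (seq nat) :=
  [:: [:: 0; 1; 3; 2; 5; 4; 7; 6; 9; 8; 10; 11];
      [:: 0; 2; 1; 4; 3; 5; 6; 8; 7; 10; 9; 11];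
      [:: 1; 0; 2; 3; 6; 7; 4; 5; 8; 9; 11; 10]]%N.

Definition coset_rep : seq (seq nat) :=
  [:: [::]; [:: 2]; [:: 2; 1]; [:: 2; 1; 0]; [:: 2; 1; 0; 1];
      [:: 2; 1; 0; 1; 0]; [:: 2; 1; 0; 1; 2]; [:: 2; 1; 0; 1; 0; 2];
      [:: 2; 1; 0; 1; 0; 2; 1]; [:: 2; 1; 0; 1; 0; 2; 1; 0];
      [:: 2; 1; 0; 1; 0; 2; 1; 0; 1]; [:: 2; 1; 0; 1; 0; 2; 1; 0; 1; 2]]%N.

(** The list of images of 0, ..., 11 under the word read from left to right, as for a right action;
    plain lists keep comparisons within reach of [vm_compute]. *)
Definition word_act (w : seq nat) : seq nat :=
  foldl (fun a i => [seq nth 0%N (nth [::] coset_step i) k | k <- a])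
    (iota 0 12) w.

Definition dihedral_words : seq (seq nat) :=
  [:: [::]; [:: 0]; [:: 1]; [:: 0; 1]; [:: 1; 0]; [:: 0; 1; 0]; [:: 1; 0; 1];
      [:: 0; 1; 0; 1]; [:: 1; 0; 1; 0]; [:: 0; 1; 0; 1; 0]]%N.

(** Normal forms: one of the ten elements of [<s, t>] followed by one of the twelve coset
    representatives, 120 words in all. *)
Definition words : seq (seq nat) :=
  [seq v ++ w | v <- dihedral_words, w <- coset_rep].

Lemma size_word_act w : size (word_act w) = 12%N.
Proof.
rewrite /word_act -[in RHS](size_iota 0 12).
by elim: w (iota 0 12) => //= j w IHw a; rewrite IHw size_map.
Qed.

Lemma uniq_word_act : uniq [seq word_act w | w <- words].
Proof. by vm_compute. Qed.

Lemma coset_stepK k i : (k < 3)%N -> (i < 12)%N ->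
  let j := nth 0%N (nth [::] coset_step k) i in
  (j < 12)%N && (nth 0%N (nth [::] coset_step k) j == i).
Proof.
have ok : all (fun k => all (fun i =>
    let j := nth 0%N (nth [::] coset_step k) i in
    (j < 12)%N && (nth 0%N (nth [::] coset_step k) j == i)) (iota 0 12))
  (iota 0 3) by vm_compute.
move=> k3 i12; have k_in : k \in iota 0 3 by rewrite mem_iota.
by apply: (allP (allP ok k k_in)); rewrite mem_iota.
Qed.

(** Letters outside the alphabet act as the identity, so that every [step_fun k] is an involution
    and [step_perm] is total. *)
Definition step_fun (k : nat) (i : 'I_12) : 'I_12 :=
  if (k < 3)%N then inord (nth 0%N (nth [::] coset_step k) i) else i.

Lemma step_funK k : involutive (step_fun k).
Proof.
move=> i; rewrite /step_fun; case: ifP => [k3 | -> //].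
have /andP[lt12 /eqP eq_i] := coset_stepK k3 (ltn_ord i).
by apply: val_inj; rewrite k3 /= !inordK ?eq_i.
Qed.

Definition step_perm k : {perm 'I_12} := perm (can_inj (step_funK k)).

Lemma step_permE w (i : 'I_12) : all (gtn 3) w ->
  word_val step_perm w i = nth 0%N (word_act w) i :> nat.
Proof.
elim/last_ind: w => [|w k IHw];
  first by rewrite [word_val _ _]big_nil perm1 nth_iota.
rewrite all_rcons => /andP[/= lt_k3 ltw]; rewrite -cats1 word_val_cat permM.
rewrite [word_val _ [:: k]]big_seq1 permE /step_fun lt_k3 IHw //.
rewrite /word_act foldl_cat /= -/(word_act w).
rewrite (nth_map 0%N) ?size_word_act ?inordK //.
by have /andP[] := coset_stepK lt_k3 (ltn_ord (word_val step_perm w i));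
  rewrite IHw.
Qed.

Lemma step_perm_eq v w : all (gtn 3) v -> all (gtn 3) w ->
  word_act v = word_act w -> word_val step_perm v = word_val step_perm w.
Proof.
by move=> v3 w3 eq_vw; apply/permP=> i; apply: val_inj;
  rewrite /= !step_permE ?eq_vw.
Qed.

Lemma word_act_eq v w : all (gtn 3) v -> all (gtn 3) w ->
  word_val step_perm v = word_val step_perm w -> word_act v = word_act w.
Proof.
move=> v3 w3 eq_vw; apply: (@eq_from_nth _ 0%N) => [|i];
  rewrite !size_word_act // => lt_i.
by rewrite -!(step_permE (Ordinal lt_i)) ?eq_vw.
Qed.

(** * Groups generated by two involutions, minima, linear characters *)

Lemma involV (rT : groupType) (x : rT) : x * x = 1 -> x^-1 = x.
Proof. by move=> xx; apply: (mulgI x); rewrite mulgV xx. Qed.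

Lemma expg_mul_invol (rT : groupType) (x y : rT) n :
  x * x = 1 -> y * y = 1 -> (x * y) ^+ n = 1 -> (y * x) ^+ n = 1.
Proof.
move=> xx yy xyn; have ->: y * x = (x * y)^-1 by rewrite invMg !involV.
by rewrite expVgn xyn invg1.
Qed.

Lemma gen_invol_norm (gT : finGroupType) (x y : gT) :
  x * x = 1 -> y * y = 1 -> <[x]> \subset 'N(<[x * y]>).
Proof.
move=> xx yy; rewrite cycle_subG; apply/normP; rewrite -cycleJ.
by rewrite conjgE !mulgA (involV xx) xx mul1g -cycleV invMg (involV xx) (involV
  yy).
Qed.

Lemma gen_invol (gT : finGroupType) (x y : gT) :
  x * x = 1 -> y * y = 1 -> <<[set x; y]>> = <[x * y]> * <[x]>.
Proof.
move=> xx yy; rewrite -norm_joinEr ?gen_invol_norm //.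
have xJ : x \in <[x * y]> <*> <[x]> by rewrite mem_gen // inE cycle_id orbT.
have xyJ : x * y \in <[x * y]> <*> <[x]> by rewrite mem_gen // inE cycle_id.
apply/eqP; rewrite eqEsubset; apply/andP; split.
  by rewrite gen_subG subUset !sub1set xJ -(groupMl y xJ).
have [xG yG] : x \in <<[set x; y]>> /\ y \in <<[set x; y]>>.
  by rewrite !mem_gen ?set21 ?set22.
by rewrite gen_subG subUset !gen_subG !sub1set groupM.
Qed.

Lemma bigminn_le (I : finType) m (P : pred I) (F : I -> nat) i :
  P i -> (\big[minn/m]_(j | P j) F j <= F i)%N.
Proof.
move=> Pi; elim: (index_enum I) (mem_index_enum i) => //= j r IHr.
rewrite inE big_cons => /predU1P[<- | /IHr le_r]; first by rewrite Pi geq_minl.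
by case: ifP => // _; rewrite geq_min le_r orbT.
Qed.

Lemma bigminn_mem m (P : pred nat) :
  (exists2 n, n < m & P n)%N -> P (\big[minn/m]_(n < m | P n) n)%N.
Proof.
case=> n lt_nm Pn; set r := \big[_/_]_(_ < _ | _) _.
have: (r == m) || P r.
  rewrite /r; elim/big_rec: _ => [|i k Pi]; first by rewrite eqxx.
  by rewrite /minn; case: ifP; rewrite ?Pi ?orbT.
rewrite orb_idl // => /eqP r_m; suff: (r <= n)%N by rewrite r_m leqNgt lt_nm.
exact: (bigminn_le _ _ (i := Ordinal lt_nm)).
Qed.

Lemma lin_char_morph (gT : finGroupType) (G : {group gT}) (phi : 'CF(G)) :
    phi 1 = 1%R -> {in G &, {morph phi : x y / x * y >-> (x * y)%R}} ->
  phi \is a linear_char.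
Proof.
move=> phi1 phiM; pose r x : 'M_1 := (phi x)%:M%R.
have rP : mx_repr G r.
  by split=> [|x y Gx Gy]; rewrite /r ?phi1 ?phiM ?scalar_mxM.
pose rG := MxRepresentation rP.
have -> : phi = cfRepr rG.
  by apply/cfun_inP=> x Gx; rewrite cfunE Gx mulr1n mxtrace_scalar mulr1n.
by rewrite qualifE /= cfRepr_char cfRepr1 eqxx.
Qed.

Lemma lin_char_gen_eq (gT : finGroupType) (G : {group gT}) (J : {set gT})
    (xi1 xi2 : 'CF(G)) :
    G :=: <<J>> -> xi1 \is a linear_char -> xi2 \is a linear_char ->
  {in J, xi1 =1 xi2} -> xi1 = xi2.
Proof.
move=> defG lin1 lin2 eq12; apply/cfun_inP=> x Gx.
have /gen_prodgP[n [c Jc ->]]: x \in <<J>> by rewrite -defG.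
have Gc i : c i \in G by rewrite defG mem_gen.
by rewrite !lin_char_prod //; apply: eq_bigr => i _; rewrite eq12.
Qed.

(** * The presentation of W, its order and its normal forms *)

Section H3.

Variables (gT : finGroupType) (W : {group gT}) (s t u : gT).
Let S := [set s; t; u].
Hypothesis coxWS : coxeter_system W S.
Hypotheses (m_st : #[s * t] = 5%N) (m_tu : #[t * u] = 3%N) (m_su : #[s * u] =
  2%N).

Definition gen k := nth 1 [:: s; t; u] k.

Lemma mem_S x : (x \in S) = [|| x == s, x == t | x == u].
Proof. by rewrite !inE orbA. Qed.

Lemma S_sub : S \subset W.
Proof. by case: coxWS => -> _ _; apply: subset_gen. Qed.

Lemma sW : s \in W. Proof. by rewrite (subsetP S_sub) ?mem_S ?eqxx. Qed.
Lemma tW : t \in W. Proof. by rewrite (subsetP S_sub) ?mem_S ?eqxx ?orbT. Qed.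
Lemma uW : u \in W. Proof. by rewrite (subsetP S_sub) ?mem_S ?eqxx ?orbT. Qed.

Lemma order_S x : x \in S -> #[x] = 2%N.
Proof. by case: coxWS => _ ordS _; apply: ordS. Qed.

Lemma sqr_S x : x \in S -> x * x = 1.
Proof. by move=> Sx; have := expg_order x;
  rewrite (order_S Sx) expgS expg1. Qed.

Lemma sqr_s : s * s = 1. Proof. by rewrite sqr_S ?mem_S ?eqxx. Qed.
Lemma sqr_t : t * t = 1. Proof. by rewrite sqr_S ?mem_S ?eqxx ?orbT. Qed.
Lemma sqr_u : u * u = 1. Proof. by rewrite sqr_S ?mem_S ?eqxx ?orbT. Qed.

Lemma neq_gens : [/\ s != t, s != u & t != u].
Proof.
by split; apply/eqP=> e; [move: m_st | move: m_su | move: m_tu];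
  rewrite e sqr_S ?order1 // mem_S eqxx ?orbT.
Qed.

(** The universal property reduced to three relations: those for a pair in the opposite order follow
    by inverting, and those for equal letters say that the images are involutions. *)
Lemma H3_hom (rT : groupType) (x : nat -> rT) :
    (forall k, (k < 3)%N -> x k * x k = 1) ->
    (x 0%N * x 1%N) ^+ 5 = 1 -> (x 1%N * x 2%N) ^+ 3 = 1 ->
    (x 0%N * x 2%N) ^+ 2 = 1 ->
  exists phi : gT -> rT, {in W &, {morph phi : y z / y * z}} /\
    forall k, (k < 3)%N -> phi (gen k) = x k.
Proof.
move=> xx x01 x12 x02; have [neq_st neq_su neq_tu] := neq_gens.
have [[xx0 xx1] xx2] := (xx 0%N isT, xx 1%N isT, xx 2%N isT).
pose f y := if y == s then x 0%N else if y == t then x 1%N else x 2%N.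
have fs : f s = x 0%N by rewrite /f eqxx.
have ft : f t = x 1%N by rewrite /f eq_sym (negPf neq_st) eqxx.
have fu : f u = x 2%N by rewrite /f !(eq_sym u) (negPf neq_su) (negPf neq_tu).
have ord_sym y z : y \in S -> z \in S -> #[z * y] = #[y * z].
  by move=> Sy Sz; rewrite -orderV invMg !involV ?sqr_S.
have [ss tS uS] : [/\ s \in S, t \in S & u \in S] by rewrite !mem_S !eqxx ?orbT.
have [_ _ univ] := coxWS.
have [|phi [phiM phiE]] := univ rT f.
  move=> y z; rewrite !mem_S.
  move=> /or3P[]/eqP-> /or3P[]/eqP->; rewrite ?fs ?ft ?fu ?sqr_S ?order1 //.
  - by rewrite m_st.
  - by rewrite m_su.
  - by rewrite ord_sym // m_st; apply: expg_mul_invol.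
  - by rewrite m_tu.
  - by rewrite ord_sym // m_su; apply: expg_mul_invol.
  - by rewrite ord_sym // m_tu; apply: expg_mul_invol.
exists phi; split=> //.
by move=> [|[|[]]] // _; rewrite phiE.
Qed.

Definition ev w := word_val gen w.

Lemma gen_S k : (k < 3)%N -> gen k \in S.
Proof. by case: k => [|[|[]]] // _; rewrite mem_S eqxx ?orbT. Qed.

Lemma ev_expg w : all (gtn 3) w -> ev w \in S ^+ size w.
Proof.
elim: w => [|k w IHw] /=; first by rewrite /ev [word_val _ _]big_nil expg0
  set11.
case/andP=> k3 w3; rewrite expgS /ev /word_val big_cons mem_mulg ?gen_S //.
exact: IHw.
Qed.

Lemma expgS_sub n : S ^+ n \subset W.
Proof.
elim: n => [|n IHn]; first by rewrite expg0 sub1G.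
by rewrite expgS mul_subG ?S_sub.
Qed.

Lemma ev_W w : all (gtn 3) w -> ev w \in W.
Proof. by move/ev_expg; apply/subsetP/expgS_sub. Qed.

Lemma hom_ev (rT : groupType) (phi : gT -> rT) (x : nat -> rT) w :
    {in W &, {morph phi : y z / y * z}} ->
    (forall k, (k < 3)%N -> phi (gen k) = x k) ->
  all (gtn 3) w -> phi (ev w) = word_val x w.
Proof.
move=> phiM phiE; elim: w => [_|k w IHw /= /andP[k3 w3]].
  rewrite /ev /word_val !big_nil; apply: (mulgI (phi 1)).
  by rewrite -phiM ?group1 // !mulg1.
rewrite /ev /word_val !big_cons phiM -?phiE //.
- by congr (_ * _); apply: IHw.
- by rewrite (subsetP S_sub) ?gen_S.
exact: ev_W.
Qed.

Lemma step_perm_hom : exists phi : gT -> {perm 'I_12},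
  forall w, all (gtn 3) w -> phi (ev w) = word_val step_perm w.
Proof.
have rel w : all (gtn 3) w -> word_act w == iota 0 12 -> word_val step_perm w =
  1.
  move=> w3 /eqP wE; rewrite (_ : 1 = word_val step_perm [::]).
    exact: step_perm_eq.
  by rewrite [word_val _ _]big_nil.
case: (@H3_hom _ step_perm).
- move=> k k3; have := rel [:: k; k];
  rewrite /word_val big_cons big_seq1 => -> //.
    by rewrite /= !k3.
  by case: k k3 => [|[|[]]].
- have := rel (flatten (nseq 5 [:: 0; 1]%N)); rewrite word_val_nseq.
  by rewrite /word_val big_cons big_seq1 => -> //; vm_compute.
- have := rel (flatten (nseq 3 [:: 1; 2]%N)); rewrite word_val_nseq.
  by rewrite /word_val big_cons big_seq1 => -> //; vm_compute.
- have := rel (flatten (nseq 2 [:: 0; 2]%N)); rewrite word_val_nseq.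
  by rewrite /word_val big_cons big_seq1 => -> //; vm_compute.
by move=> phi [phiM phiE]; exists phi => w w3; apply: hom_ev.
Qed.

Lemma ev_act v w : all (gtn 3) v -> all (gtn 3) w -> ev v = ev w ->
  word_act v = word_act w.
Proof.
have [phi phiE] := step_perm_hom => v3 w3 eq_vw.
by apply: word_act_eq => //; rewrite -!phiE // eq_vw.
Qed.

Lemma braid_su : s * u = u * s.
Proof.
have := expg_order (s * u); rewrite m_su expgS expg1 => su2.
by rewrite -[LHS](involV su2) invMg (involV sqr_s) (involV sqr_u).
Qed.

Lemma braid_tu : u * t * u = t * u * t.
Proof.
apply: (mulgI (t * u * t)); rewrite !mulgA.
rewrite -(mulgA _ t t) sqr_t mulg1 -(mulgA _ u u) sqr_u mulg1 sqr_t.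
by rewrite -(expg_order (t * u)) m_tu !expgS expg0 mulg1 !mulgA.
Qed.

Lemma braid_st : t * s * t * s * t = s * t * s * t * s.
Proof.
apply: (mulgI (s * t * s * t * s)); rewrite !mulgA.
do 2![rewrite -(mulgA _ s s) sqr_s mulg1 -(mulgA _ t t) sqr_t mulg1].
by rewrite sqr_s -(expg_order (s * t)) m_st !expgS expg0 mulg1 !mulgA.
Qed.

(** A hand-checked coset table: the union of the cosets [<s, t> y] over the twelve representatives
    [y] is stable under right multiplication by the generators. It is proved from the braid
    relations alone, since the order of W is not yet known. *)
Lemma coset_rep_step k i : (k < 3)%N -> (i < 12)%N ->
  let y j := ev (nth [::] coset_rep j) in
  exists2 p, p \in [set 1; s; t] &
    y i * gen k = p * y (nth 0%N (nth [::] coset_step k) i).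
Proof.
have css x : x * s * s = x by rewrite -mulgA sqr_s mulg1.
have ctt x : x * t * t = x by rewrite -mulgA sqr_t mulg1.
have cuu x : x * u * u = x by rewrite -mulgA sqr_u mulg1.
have csu x : x * s * u = x * u * s by rewrite -!mulgA braid_su.
have ctu x : x * u * t * u = x * t * u * t by have := braid_tu;
  rewrite -!mulgA => ->.
have cst x : x * t * s * t * s * t = x * s * t * s * t * s.
  by have := braid_st; rewrite -!mulgA => ->.
(* [L]i is the case where a generator fixes the coset of the i-th representative, i > 0, so that a
   letter s or t comes out on the left; [L11'] is the second such generator for i = 11. *)
have L1 := esym braid_su; have L2 := braid_tu.
have L3 : u * t * s * u = t * u * t * s by rewrite csu braid_tu.
have L5 : u * t * s * t * s * t = s * u * t * s * t * s by rewrite cst braid_su.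
have L6 : u * t * s * t * u * t = t * u * t * s * t * u.
  by rewrite -ctu L3.
have L8 : u * t * s * t * s * u * t * u = s * u * t * s * t * s * u * t.
  by rewrite ctu L5.
have L9 : u * t * s * t * s * u * t * s * u = s * u * t * s * t * s * u * t * s.
  by rewrite csu L8.
have L10 : u * t * s * t * s * u * t * s * t * s =
           t * u * t * s * t * s * u * t * s * t.
  by rewrite csu -cst L6 -csu.
have L11 : u * t * s * t * s * u * t * s * t * u * s =
           t * u * t * s * t * s * u * t * s * t * u.
  by rewrite -csu L10.
have L11' : u * t * s * t * s * u * t * s * t * u * t =
           s * u * t * s * t * s * u * t * s * t * u.
  by rewrite -ctu L9.
have P1 : 1 \in [set 1; s; t] by rewrite !inE eqxx.
have Ps : s \in [set 1; s; t] by rewrite !inE eqxx orbT.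
have Pt : t \in [set 1; s; t] by rewrite !inE eqxx orbT.
have evE w : ev w = foldl mulg 1 [seq gen j | j <- w].
  elim/last_ind: w => [|w j IHw]; first by rewrite /ev [word_val _ _]big_nil.
  by rewrite map_rcons foldl_rcons -IHw /ev -cats1 word_val_cat [word_val _ [::
    j]]big_seq1.
move=> k3 i12 /=; rewrite !evE.
case: k k3 => [|[|[|//]]] _; do 12?[case: i i12 => [|i] i12 //].
all: rewrite /gen /= ?mul1g ?mulg1.
all: try by exists 1; rewrite ?mul1g ?csu ?css ?ctt ?cuu ?sqr_u.
all: first [by exists s; rewrite ?mulg1 ?mulgA | by exists t;
  rewrite ?mulg1 ?mulgA].
Qed.

Lemma all_words w : w \in words -> all (gtn 3) w.
Proof. by move: w; apply/allP; vm_compute. Qed.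

Lemma ev_inj : {in words &, injective ev}.
Proof.
move=> v w vw ww /ev_act eq_act.
by apply: (uniq_map_inj uniq_word_act) => //; apply: eq_act; apply: all_words.
Qed.

Lemma uniq_ev : uniq (map ev words).
Proof. by rewrite map_inj_in_uniq ?(map_uniq uniq_word_act) //;
  apply: ev_inj. Qed.

(** Ten elements of [<s, t>] times twelve representatives give a set that contains 1 and is closed
    under right multiplication by S, hence contains W. *)
Lemma card_W_le : (#|W| <= 120)%N.
Proof.
pose P := <<[set s; t]>>.
have cardP : (#|P| <= 10)%N.
  rewrite /P gen_invol ?sqr_s ?sqr_t //.
  have := mul_cardG <[s * t]> <[s]>;
    rewrite -!orderE m_st (order_S (x := s)) ?mem_S ?eqxx //.
  by move=> cardM; rewrite -[10%N]/(5 * 2)%N cardM leq_pmulr ?cardG_gt0.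
pose f (q : gT * 'I_12) := q.1 * ev (nth [::] coset_rep q.2).
pose U := [set f q | q in setX P setT].
have leU : (#|U| <= 120)%N.
  rewrite (leq_trans (leq_imset_card _ _)) // cardsX cardsT card_ord.
  by rewrite (leq_mul cardP (leqnn 12)).
apply: leq_trans (subset_leq_card _) leU.
have sP : s \in P by rewrite mem_gen ?set21.
have tP : t \in P by rewrite mem_gen ?set22.
have U1 : 1 \in U.
  apply/imsetP; exists (1, ord0); rewrite ?inE ?group1 //.
  by rewrite /f /= /ev [word_val _ _]big_nil mulg1.
have US x y : x \in U -> y \in S -> x * y \in U.
  case/imsetP=> [[p i] /setXP[/= Pp _] ->] Sy.
  have [k k3 ->] : exists2 k, (k < 3)%N & y = gen k.
    move: Sy; rewrite mem_S => /or3P[]/eqP->;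
      [by exists 0%N | by exists 1%N | by exists 2%N].
  have [q qE] := coset_rep_step k3 (ltn_ord i).
  rewrite /f /= -mulgA => ->.
  have /andP[j12 _] := coset_stepK k3 (ltn_ord i).
  apply/imsetP; exists (p * q, Ordinal j12);
    rewrite ?mulgA // !inE andbT groupM //.
  by move: qE; rewrite !inE => /orP[/orP[]|]/eqP->.
case: coxWS => -> _ _; apply/subsetP=> x /gen_prodgP[n [c Sc ->]] {x}.
elim: n => [|n IHn] in c Sc *; first by rewrite big_ord0.
by rewrite big_ord_recr US // IHn.
Qed.

Lemma ev_sub_W : {subset map ev words <= enum W}.
Proof. by move=> _ /mapP[w /all_words w3 ->]; rewrite mem_enum ev_W. Qed.

Lemma card_W : #|W| = 120%N.
Proof.
have [|le120 _] := uniq_min_size uniq_ev ev_sub_W;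
  last by rewrite cardE -le120 size_map.
by rewrite size_map -cardE card_W_le.
Qed.

Lemma words_W : W =i map ev words.
Proof.
have [|_ eqW x] := uniq_min_size uniq_ev ev_sub_W; last by rewrite eqW mem_enum.
by rewrite size_map -cardE card_W_le.
Qed.

(** The decision procedure for all later computations. The coset action is faithful, because every
    element is one of the 120 normal forms and these act differently. *)
Lemma ev_eq v w : all (gtn 3) v -> all (gtn 3) w ->
  (ev v == ev w) = (word_act v == word_act w).
Proof.
move=> v3 w3; apply/eqP/eqP; first exact: ev_act.
have /mapP[v' v'w eqv] : ev v \in map ev words by rewrite -words_W ev_W.
have /mapP[w' w'w eqw] : ev w \in map ev words by rewrite -words_W ev_W.
have [v'3 w'3] := (all_words v'w, all_words w'w).
rewrite (ev_act v3 v'3 eqv) (ev_act w3 w'3 eqw) eqv eqw => eq_act.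
by congr ev; apply: (uniq_map_inj uniq_word_act).
Qed.

Lemma card_words (P : pred gT) : #|[set x in W | P x]| = count (P \o ev) words.
Proof.
rewrite -count_map -size_filter -(card_uniqP (filter_uniq _ uniq_ev)).
by apply: eq_card => x; rewrite inE mem_filter words_W andbC.
Qed.

Lemma forall_words (P : pred gT) (q : pred (seq nat)) :
    (forall w, all (gtn 3) w -> q w -> P (ev w)) -> all q words ->
  {in W, forall x, P x}.
Proof.
move=> qP /allP q_words x; rewrite words_W => /mapP[w ww ->].
by rewrite qP ?all_words ?q_words.
Qed.

Lemma expgS_ev n x : x \in S ^+ n ->
  exists2 v, all (gtn 3) v & size v = n /\ x = ev v.
Proof.
elim: n x => [|n IHn] x.
  by rewrite expg0 => /set1P->; exists [::] => //;
    rewrite /ev [word_val _ _]big_nil.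
rewrite expgS => /mulsgP[y z Sy /IHn[v v3 [sz_v ->]] ->] {x z}.
have [k k3 ->] : exists2 k, (k < 3)%N & y = gen k.
  move: Sy; rewrite mem_S => /or3P[]/eqP->;
    [by exists 0%N | by exists 1%N | by exists 2%N].
exists (k :: v); first by rewrite /= k3.
by rewrite /= sz_v /ev /word_val big_cons.
Qed.

Lemma size_words w : w \in words -> (size w < 120)%N.
Proof. by move: w; apply/allP; vm_compute. Qed.

Lemma cox_length_mem x : x \in W -> x \in S ^+ cox_length S x.
Proof.
rewrite words_W => /mapP[w ww xE];
  apply: (@bigminn_mem _ (fun n => x \in S ^+ n)); exists (size w).
  by rewrite (leq_trans (size_words ww)) // -card_W max_card.
by rewrite xE ev_expg ?all_words.
Qed.

(** Sending each generator to the transposition of two points respects the relations, so word parity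
    is the parity of a permutation. *)
Lemma odd_size_ev v w : all (gtn 3) v -> all (gtn 3) w -> ev v = ev w ->
  odd (size v) = odd (size w).
Proof.
case: (@H3_hom _ (fun=> tperm (ord0 : 'I_2) ord_max)) => [k _||||phi [phiM
  phiE]].
- by rewrite tperm2.
- by rewrite tperm2 expg1n.
- by rewrite tperm2 expg1n.
- by rewrite tperm2 expg1n.
have phi_odd w' : all (gtn 3) w' -> odd_perm (phi (ev w')) = odd (size w').
  move=> w'3; rewrite (hom_ev phiM phiE w'3); elim: w' {w'3} => [|k w' IHw].
    by rewrite [word_val _ _]big_nil odd_perm1.
  by rewrite /word_val big_cons odd_permM odd_tperm /= -IHw.
by move=> v3 w3 eq_vw; rewrite -!phi_odd // eq_vw.
Qed.

(** * The sign character *)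

Variable omega : 'CF(W).
Hypothesis omegaE : {in W, forall w, omega w = ((-1) ^+ cox_length S w)%R}.

Lemma omega_ev w : all (gtn 3) w -> omega (ev w) = ((-1) ^+ size w)%R.
Proof.
move=> w3; rewrite omegaE ?ev_W //.
have [v v3 [<- /esym/odd_size_ev eq_vw]] := expgS_ev (cox_length_mem (ev_W w3)).
by rewrite -signr_odd eq_vw // signr_odd.
Qed.

Lemma omegaM : {in W &, {morph omega : x y / x * y >-> (x * y)%R}}.
Proof.
move=> x y; rewrite !words_W => /mapP[v /all_words v3 ->] /mapP[w /all_words w3
  ->].
by rewrite -word_val_cat !omega_ev ?all_cat ?v3 // size_cat exprD.
Qed.

Lemma omega1 : omega 1 = 1%R.
Proof. by have := @omega_ev [::] isT; rewrite /ev [word_val _ _]big_nil. Qed.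

Lemma omega_gen x : x \in S -> omega x = (-1)%R.
Proof.
rewrite mem_S => /or3P[]/eqP->; [have:= @omega_ev [:: 0%N] isT
  | have:= @omega_ev [:: 1%N] isT | have:= @omega_ev [:: 2%N] isT];
by rewrite /ev [word_val _ _]big_seq1.
Qed.

Lemma omega_lin : omega \is a linear_char.
Proof. by apply: lin_char_morph omega1 omegaM. Qed.

Lemma omega_sign x : x \in W -> (omega x == 1%R) || (omega x == (-1)%R).
Proof.
rewrite words_W => /mapP[w /all_words w3 ->]; rewrite omega_ev // -signr_odd.
by case: (odd _); rewrite ?expr0 ?expr1 eqxx ?orbT.
Qed.

(** * Computed facts: centralisers, normalisers and the central element [w0] *)

Lemma card_words_act (p : pred gT) (q : pred (seq nat)) :
  (forall w, all (gtn 3) w -> p (ev w) = q w) ->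
  #|[set x in W | p x]| = count q words.
Proof.
move=> pq; rewrite card_words; apply: eq_in_count => w /all_words w3.
exact: pq.
Qed.

Lemma card_cent1_ev v : all (gtn 3) v ->
  #|'C_W[ev v]| = count (fun w => word_act (w ++ v) == word_act (v ++ w)) words.
Proof.
move=> v3; rewrite -(@card_words_act (fun x => x * ev v == ev v * x)) => [|w
  w3].
  by apply: eq_card => x; rewrite in_setI [in RHS]inE cent1E eq_sym.
by rewrite -!word_val_cat ev_eq // all_cat v3 w3.
Qed.

(** The set counted is the normaliser of the cyclic group generated by [ev v]; its order gives the
    values of A and B on rotations. *)
Lemma card_cycle_conj_ev v : all (gtn 3) v ->
  #|[set x in W | ev v ^ x \in <[ev v]>]| =
  count (fun w => has (fun k => word_act (v ++ w) == word_act (w ++ flatten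
    (nseq k v)))
                      (iota 0 #[ev v])) words.
Proof.
move=> v3; apply: card_words_act => w w3;
  have nv3 k : all (gtn 3) (flatten (nseq k v)).
  by elim: k => //= k IHk; rewrite all_cat v3.
have evv k : (ev v ^ ev w == ev v ^+ k) = (word_act (v ++ w) == word_act (w ++
  flatten (nseq k v))).
  rewrite -ev_eq ?all_cat ?v3 ?w3 ?nv3 // /ev !word_val_cat word_val_nseq
    -!/(ev _).
  by rewrite conjgE (can2_eq (mulKVg _) (mulKg _)).
apply/idP/hasP=> [/cyclePmin[k lt_k /eqP] | [k _]].
  by rewrite evv => kE; exists k; rewrite ?mem_iota.
by rewrite -evv => /eqP->; apply: mem_cycle.
Qed.

Definition w0 := (s * t * u) ^+ 5.

Definition w0_word := flatten (nseq 5 [:: 0; 1; 2]%N).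

Lemma w0_word3 : all (gtn 3) w0_word. Proof. by []. Qed.

Lemma w0E : w0 = ev w0_word.
Proof. by rewrite /w0 /ev word_val_nseq /word_val !big_cons big_nil mulg1
  !mulgA. Qed.

Lemma stE : s * t = ev [:: 0; 1]%N.
Proof. by rewrite /ev /word_val !big_cons big_nil mulg1. Qed.
Lemma tuE : t * u = ev [:: 1; 2]%N.
Proof. by rewrite /ev /word_val !big_cons big_nil mulg1. Qed.
Lemma suE : s * u = ev [:: 0; 2]%N.
Proof. by rewrite /ev /word_val !big_cons big_nil mulg1. Qed.

Lemma w0W : w0 \in W. Proof. by rewrite w0E ev_W. Qed.

Lemma omega_w0 : omega w0 = (-1)%R.
Proof. by rewrite w0E omega_ev // -signr_odd. Qed.

Lemma sqr_w0 : w0 * w0 = 1.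
Proof.
apply/eqP; have -> : 1 = ev [::] by rewrite /ev [word_val _ _]big_nil.
by rewrite w0E -word_val_cat ev_eq.
Qed.

Lemma w0_central : {in W, forall x, commute w0 x}.
Proof.
move=> x Wx; apply/eqP; move: x Wx.
apply: (@forall_words (fun x => w0 * x == x * w0)
  (fun w => word_act (w0_word ++ w) == word_act (w ++ w0_word))) => [w w3 qw|].
  by rewrite w0E -!word_val_cat ev_eq ?all_cat ?w3 ?w0_word3.
by vm_compute.
Qed.

Lemma card_cent_su : #|'C_W[s * u]| = 8%N.
Proof. by rewrite suE card_cent1_ev //; vm_compute. Qed.
Lemma card_cent_st : #|'C_W[s * t]| = 10%N.
Proof. by rewrite stE card_cent1_ev //; vm_compute. Qed.
Lemma card_cent_tu : #|'C_W[t * u]| = 6%N.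
Proof. by rewrite tuE card_cent1_ev //; vm_compute. Qed.

Lemma card_norm_st : #|[set x in W | (s * t) ^ x \in <[s * t]>]| = 20%N.
Proof. by rewrite stE card_cycle_conj_ev // -stE m_st; vm_compute. Qed.
Lemma card_norm_tu : #|[set x in W | (t * u) ^ x \in <[t * u]>]| = 12%N.
Proof. by rewrite tuE card_cycle_conj_ev // -tuE m_tu; vm_compute. Qed.

(** Both elements have order 5, so orders cannot tell their classes apart and a check over all of W
    is made instead. *)
Lemma st_conj_neq : {in W, forall x, (s * t) ^ x != (s * t) ^+ 2}.
Proof.
apply: (@forall_words (fun x => (s * t) ^ x != (s * t) ^+ 2) (fun w =>
   word_act ([:: 0; 1]%N ++ w) != word_act (w ++ [:: 0; 1; 0;
     1]%N))) => [w w3|].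
  rewrite -ev_eq ?all_cat ?w3 // /ev !word_val_cat -!/(ev _) -stE.
  apply: contra => /eqP st_w; rewrite conjgC; apply/eqP; congr (_ * _).
  rewrite st_w expgS expg1.
  by rewrite /ev /word_val !big_cons big_nil mulg1 !mulgA.
by vm_compute.
Qed.

(** * The even subgroup and the dihedral parabolic subgroups *)

Local Notation N := (cfker omega).

Lemma mem_kerE x : x \in W -> (x \in N) = (omega x == 1%R).
Proof.
by move=> Wx; rewrite cfkerEchar ?lin_charW ?omega_lin // inE Wx omega1.
Qed.

Lemma notin_kerE x : x \in W -> (x \notin N) = (omega x == (-1)%R).
Proof.
move=> Wx; rewrite mem_kerE //; have := omega_sign Wx.
have one_neqN : (1 == -1 :> algC)%R = false by rewrite eq_sym eqNr oner_eq0.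
by case/orP=> /eqP->; rewrite ?eqxx ?one_neqN // eq_sym one_neqN.
Qed.

Lemma w0_notin : w0 \notin N.
Proof. by rewrite notin_kerE ?w0W ?omega_w0. Qed.

Lemma odd_mul_ker x y : x \in W -> y \in W -> x \notin N -> y \notin N -> x * y
  \in N.
Proof.
move=> Wx Wy; rewrite !notin_kerE // mem_kerE ?groupM // omegaM //.
by move=> /eqP-> /eqP->; rewrite mulrNN mulr1.
Qed.

Lemma card_odd (H : {group gT}) : H \subset W -> ~~ (H \subset N) ->
  #|H| = (2 * #|H :&: N|)%N.
Proof.
move=> sHW /subsetPn[y Hy Ny]; have Wy := subsetP sHW y Hy.
rewrite -(cardsID N H) mul2n -addnn; congr (_ + _)%N.
rewrite -(card_rcoset _ y); apply: eq_card => x;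
  rewrite mem_rcoset in_setD in_setI andbC.
rewrite groupMr ?groupV //; case Hx: (x \in H) => //=;
  have Wx := subsetP sHW x Hx.
case Nx: (x \in N); last by rewrite odd_mul_ker ?groupV ?Nx.
by rewrite groupMl ?groupV // (negPf Ny).
Qed.

Lemma S_notin_ker x : x \in S -> x \notin N.
Proof. by move=> Sx; rewrite notin_kerE ?(subsetP S_sub) // omega_gen. Qed.

Lemma dihedral_sub x y : x \in S -> y \in S -> <<[set x; y]>> \subset W.
Proof.
by move=> Sx Sy; rewrite gen_subG subUset !sub1set !(subsetP S_sub).
Qed.

Lemma dihedral_ker x y : x \in S -> y \in S ->
  <<[set x; y]>> :&: N = <[x * y]>.
Proof.
move=> Sx Sy; have [Wx Wy] := (subsetP S_sub x Sx, subsetP S_sub y Sy).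
have Nxy : <[x * y]> \subset N by rewrite cycle_subG odd_mul_ker ?S_notin_ker.
apply/setP=> z; rewrite in_setI gen_invol ?sqr_S //; apply/andP/idP=> [[] | Cz].
  case/mulsgP=> a b Ca /cyclePmin[k lt_k ->] -> {z b}.
  rewrite (groupMl _ (subsetP Nxy _ Ca)) (groupMl _ Ca).
  move: lt_k; rewrite order_S //.
  case: k => [|[|[]]] // _; first by rewrite expg0 group1.
  by rewrite expg1 (negPf (S_notin_ker Sx)).
by rewrite (subsetP Nxy) // (subsetP (mulG_subl _ _)).
Qed.

Lemma card_dihedral x y : x \in S -> y \in S ->
  #|<<[set x; y]>>| = (2 * #[x * y])%N.
Proof.
move=> Sx Sy; rewrite card_odd ?dihedral_sub ?dihedral_ker //.
by apply/subsetPn; exists x; rewrite ?S_notin_ker // mem_gen ?set21.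
Qed.

(* Odd elements are x c with c in <xy>; c has a square root d in <xy>, and x   *)
(* inverts d, so that x c = x ^ d.                                             *)
Lemma dihedral_odd_conj x y z : x \in S -> y \in S -> odd #[x * y] ->
  z \in <<[set x; y]>> -> z \notin N -> exists2 d, d \in W & z = x ^ d.
Proof.
move=> Sx Sy odd_xy Dz Nz; have [Wx Wy] := (subsetP S_sub x Sx, subsetP S_sub y
  Sy).
have xx := sqr_S Sx.
have xD : x \in <<[set x; y]>> by rewrite mem_gen ?set21.
have: x * z \in <[x * y]>.
  rewrite -(dihedral_ker Sx Sy) in_setI groupM //= odd_mul_ker ?(S_notin_ker
    Sx) //.
  by rewrite (subsetP (dihedral_sub Sx Sy)).
case/cycleP=> k xzE; exists ((x * y) ^+ (k * (#[x * y]./2).+1));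
  first by rewrite groupX ?groupM.
have half2 : ((#[x * y]./2).+1).*2 = (#[x * y]).+1.
  by rewrite doubleS -[in RHS](odd_double_half #[x * y]) odd_xy add1n.
have inv : x * (x * y) ^+ (k * (#[x * y]./2).+1) * x = ((x * y) ^+ (k * (#[x *
  y]./2).+1))^-1.
  rewrite -{1}(involV xx) -mulgA -conjgE conjXg -expgVn; congr (_ ^+ _).
  by rewrite conjgE !mulgA mulVg mul1g invMg (involV xx) (involV (sqr_S Sy)).
rewrite conjgE -inv -!mulgA (mulgA x x) xx mul1g -expgD -mulnDr addnn half2.
by rewrite mulnS expgD mulnC expgM expg_order expg1n mulg1 -xzE mulgA xx mul1g.
Qed.

Local Notation P := <<[set s; t]>>%G.
Local Notation K := <<[set t; u]>>%G.
Local Notation R := <<[set s; u]>>%G.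

Lemma gens_in_S : [/\ s \in S, t \in S & u \in S].
Proof. by rewrite !mem_S !eqxx ?orbT. Qed.

Lemma conj_st : exists2 d, d \in W & t = s ^ d.
Proof.
have [Ss St _] := gens_in_S.
by apply: (dihedral_odd_conj Ss St); rewrite ?m_st ?mem_gen ?set22 ?S_notin_ker.
Qed.

Lemma conj_tu : exists2 d, d \in W & u = t ^ d.
Proof.
have [_ St Su] := gens_in_S.
by apply: (dihedral_odd_conj St Su); rewrite ?m_tu ?mem_gen ?set22 ?S_notin_ker.
Qed.

Lemma conj_su : exists2 d, d \in W & u = s ^ d.
Proof.
have [d Wd tE] := conj_st; have [e We uE] := conj_tu.
by exists (d * e); rewrite ?groupM // conjgM -tE.
Qed.

Lemma card_conj_eq g z w : w \in W ->
  #|[set y in W | g ^ y == z ^ w]| = #|[set y in W | g ^ y == z]|.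
Proof.
move=> Ww; rewrite -[RHS](card_rcoset _ w); apply: eq_card => y.
rewrite mem_rcoset [in LHS]inE [in RHS]inE groupMr ?groupV //; congr (_ && _).
by rewrite conjgM (can2_eq (conjgKV w) (conjgK w)).
Qed.

(** * Values of the permutation characters A and B *)

Lemma Ind1_ge0 (H : {group gT}) g : H \subset W -> (0 <= 'Ind[W, H] 1 g)%R.
Proof.
move=> sHW; rewrite cfIndE // mulr_ge0 ?invr_ge0 ?ler0n // sumr_ge0 // => y _.
by rewrite cfun1E ler0n.
Qed.

Lemma Ind1E (H : {group gT}) g : H \subset W ->
  'Ind[W, H] 1%R g = (#|[set y in W | (g ^ y)%g \in H]|%:R / #|H|%:R)%R.
Proof.
move=> sHW; rewrite cfIndE // mulrC; congr (_ * _)%R.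
rewrite (eq_bigr (fun z => ((g ^ z)%g \in H)%:R%R)); last by move=> z _;
  rewrite cfun1E.
rewrite -natr_sum -big_mkcondr /= sum1dep_card; congr (_%:R)%R.
Qed.

(* The odd elements of the dihedral group D = <x, y> are half of it, and they  *)
(* are all conjugate to x.                                                     *)
Lemma Ind_dihedral_odd x y g : x \in S -> y \in S -> odd #[x * y] ->
    g \in W -> g \notin N ->
  'Ind[W, <<[set x; y]>>%G] 1%R g = (#|[set z in W | (g ^ z)%g == x]|%:R /
    2%:R)%R.
Proof.
move=> Sx Sy odd_xy Wg Ng; set D := <<_>>%G; set c := #|_|.
have sDW : D \subset W by apply: dihedral_sub.
have cardD : #|D| = (2 * #[x * y])%N by apply: card_dihedral.
have cardDN : #|D :\: N| = #[x * y].
  have := cardsID N D; rewrite dihedral_ker // cardD mul2n -addnn => /addnI.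
  by [].
have cardE : #|[set z in W | g ^ z \in D]| = (#[x * y] * c)%N.
  rewrite -sum1_card (partition_big (fun z => g ^ z) (mem (D :\: N))) => [|z]
    /=; last first.
    rewrite inE => /andP[Wz Dgz]; rewrite in_setD Dgz andbT memJ_norm //.
    by rewrite (subsetP (cfker_norm _)).
  rewrite -cardDN -sum_nat_const; apply: eq_bigr => z;
    rewrite in_setD => /andP[Nz Dz].
  have [d Wd zE] := dihedral_odd_conj Sx Sy odd_xy Dz Nz.
  rewrite sum1dep_card /c -(card_conj_eq g x Wd) -zE; apply: eq_card => w.
  rewrite [in LHS]inE [in LHS]inE [in RHS]inE.
  by case: eqP => [-> | _]; rewrite ?andbF // Dz !andbT.
rewrite Ind1E // cardE cardD mulnC !natrM invfM mulrACA mulfV ?mulr1 //.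
by rewrite pnatr_eq0 -lt0n.
Qed.

Lemma Ind_dihedral_even x y g : x \in S -> y \in S -> g \in N ->
  'Ind[W, <<[set x; y]>>%G] 1%R g =
  (#|[set z in W | (g ^ z)%g \in <[x * y]>%g]|%:R / (2 * #[x * y]%g)%:R)%R.
Proof.
move=> Sx Sy Ng; rewrite Ind1E ?dihedral_sub // card_dihedral //.
congr (_%:R / _)%R; apply: eq_card => z; rewrite [in LHS]inE [in RHS]inE.
case Wz: (z \in W) => //=; rewrite -(dihedral_ker Sx Sy) in_setI.
by rewrite (memJ_norm _ (subsetP (cfker_norm omega) z Wz)) Ng andbT.
Qed.

Lemma Ind_dihedral_eq0 x y g : x \in S -> y \in S -> g \in N ->
  ~~ (#[g] %| #[x * y])%N -> 'Ind[W, <<[set x; y]>>%G] 1%R g = 0%R.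
Proof.
move=> Sx Sy Ng ndv; rewrite Ind_dihedral_even // [X in X%:R%R]eq_card0 ?mul0r
  // => z.
rewrite [in LHS]inE; apply/negP=> /andP[_ /order_dvdG].
by rewrite -orderE orderJ (negPf ndv).
Qed.

Local Notation A := ('Ind[W, P] 1%R).
Local Notation B := ('Ind[W, K] 1%R).

(** By [Ind_dihedral_odd] both values are half the number of elements conjugating [g] to a given
    generator, and s and t are conjugate. This is why A + omega B vanishes on odd elements. *)
Lemma AB_odd g : g \in W -> g \notin N -> A g = B g.
Proof.
have [Ss St Su] := gens_in_S; have [d Wd tE] := conj_st.
move=> Wg Ng; rewrite !Ind_dihedral_odd ?m_st ?m_tu //.
by rewrite -(card_conj_eq g s Wd) tE.
Qed.

Lemma ker_gens : [/\ s * t \in N, t * u \in N & s * u \in N].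
Proof.
have [Ss St Su] := gens_in_S; have [Ws Wt Wu] := And3 sW tW uW.
by split; rewrite odd_mul_ker ?S_notin_ker.
Qed.

Lemma Ind1_index (H : {group gT}) : H \subset W ->
  'Ind[W, H] 1%R 1%g = (120 %/ #|H|)%:R%R.
Proof.
by move=> sHW; rewrite cfInd1 // cfun11 mulr1 -divgS // card_W.
Qed.

Lemma A_1 : A 1%g = 12%:R%R.
Proof.
have [Ss St Su] := gens_in_S.
by rewrite Ind1_index ?dihedral_sub // card_dihedral // m_st.
Qed.

Lemma B_1 : B 1%g = 20%:R%R.
Proof.
have [Ss St Su] := gens_in_S.
by rewrite Ind1_index ?dihedral_sub // card_dihedral // m_tu.
Qed.

Lemma A_st : A (s * t)%g = 2%:R%R.
Proof.
have [Ss St Su] := gens_in_S; have [Nst _ _] := ker_gens.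
rewrite Ind_dihedral_even // card_norm_st m_st.
by apply: canLR (mulfK _) _; rewrite -?natrM ?pnatr_eq0.
Qed.

Lemma B_tu : B (t * u)%g = 2%:R%R.
Proof.
have [Ss St Su] := gens_in_S; have [_ Ntu _] := ker_gens.
rewrite Ind_dihedral_even // card_norm_tu m_tu.
by apply: canLR (mulfK _) _; rewrite -?natrM ?pnatr_eq0.
Qed.

Lemma order_st2 : #[(s * t) ^+ 2] = 5%N.
Proof. by rewrite orderXgcd m_st. Qed.

Lemma A_st2 : A ((s * t) ^+ 2)%g = 2%:R%R.
Proof.
have [Ss St Su] := gens_in_S; have [Nst _ _] := ker_gens.
rewrite -A_st !Ind_dihedral_even ?groupX //; congr (_%:R / _)%R.
apply: eq_card => z; rewrite [in LHS]inE [in RHS]inE; congr (_ && _).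
rewrite conjXg; apply/idP/idP=> [|/groupX->//] st2.
(* An element of order dividing 5 is the cube of its square, since 6 = 1 modulo 5; so s t and its
   square generate the same cyclic group. *)
have -> : (s * t) ^ z = (((s * t) ^ z) ^+ 2) ^+ 3; last exact: groupX.
by rewrite -expgM -[(2 * 3)%N]/(1 + 5)%N expgD -[5%N]m_st -(orderJ (s * t) z)
  expg_order mulg1.
Qed.

(** * The character C *)

Lemma lin_involution (G : {group gT}) (xi : 'CF(G)) x :
  xi \is a linear_char -> x \in G -> x * x = 1 -> (xi x == 1%R) || (xi x ==
    (-1)%R).
Proof.
by move=> xi_lin Gx xx; rewrite -sqrf_eq1 expr2 -lin_charM // xx lin_char1.
Qed.

Lemma cfdot_inj (G : {group gT}) (phi1 phi2 : 'CF(G)) :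
  (forall psi, '[psi, phi1] = '[psi, phi2])%R -> phi1 = phi2.
Proof.
move=> eq_dot; apply/eqP; rewrite -subr_eq0 -cfnorm_eq0 cfdotBr.
by rewrite eq_dot subrr.
Qed.

Lemma R_elements : R = [set 1; s; u; s * u] :> {set gT}.
Proof.
apply/setP=> x; have [Ss _ Su] := gens_in_S.
rewrite !inE; apply/idP/idP; last first.
  have [Rs Ru] : s \in R /\ u \in R by rewrite !mem_gen ?set21 ?set22.
  by case/orP=> [/orP[/orP[]|]|] /eqP-> //; rewrite groupM.
rewrite /= gen_invol ?sqr_S // => /mulsgP[y z /cyclePmin[i + ->] /cyclePmin[j +
  ->] ->].
rewrite m_su order_S //; case: i => [|[|[]]] // _; case: j => [|[|[]]] // _.
- by rewrite !expg0 mulg1 eqxx.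
- by rewrite expg0 expg1 mul1g eqxx orbT.
- by rewrite expg0 expg1 mulg1 eqxx !orbT.
by rewrite !expg1 braid_su -mulgA sqr_s mulg1 eqxx !orbT.
Qed.

Lemma R_invol x : x \in R -> x * x = 1.
Proof.
have := expg_order (s * u); rewrite m_su expgS expg1 => su2.
by rewrite /= R_elements !inE => /orP[/orP[/orP[]|]|] /eqP-> //;
  rewrite ?mulg1 ?sqr_s ?sqr_u.
Qed.

Lemma sum_R (F : gT -> algC) : (\sum_(x in R) F x = F 1%g + F s + F u + F (s *
  u)%g)%R.
Proof.
have [_ neq_su _] := neq_gens; have [Ss St Su] := gens_in_S.
have [Ws Wu] := (sW, uW); have [_ _ Nsu] := ker_gens.
have [Ns Nu] := (S_notin_ker Ss, S_notin_ker Su).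
have neqN x y : x \in N -> y \notin N -> x != y by move=> Nx;
  apply: contraNneq => <-.
have neq_su1 : 1 != s * u by apply/eqP=> e; have := m_su; rewrite -e order1.
have uR : uniq [:: 1; s; u; s * u].
  rewrite /= !inE !negb_or neq_su1 neq_su !(neqN 1) ?group1 //=.
  by rewrite ![_ == s * u]eq_sym !(neqN (s * u)).
rewrite (eq_bigl (mem [:: 1; s; u; s * u])) => [|x].
  by rewrite -big_uniq //= !big_cons big_nil /= addr0 !addrA.
by rewrite R_elements !inE -!orbA.
Qed.

Lemma subRW : R \subset W.
Proof. by have [Ss _ Su] := gens_in_S; apply: dihedral_sub. Qed.

Lemma card_R : #|R| = 4%N.
Proof. by have [Ss _ Su] := gens_in_S; rewrite card_dihedral // m_su. Qed.

Lemma gens_in_R : s \in R /\ u \in R.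
Proof. by rewrite !mem_gen ?set21 ?set22. Qed.

Lemma cfun_su (psi : 'CF(W)) : psi u = psi s.
Proof. by have [d Wd ->] := conj_su; rewrite cfunJ. Qed.

Section SplitCharacter.

Variable beta : 'CF(R).
Hypotheses (beta_lin : beta \is a linear_char) (beta_su : beta s != beta u).

Lemma split_u : beta u = (- beta s)%R.
Proof.
have [Rs Ru] := gens_in_R; move: beta_su.
case/orP: (lin_involution beta_lin Rs sqr_s) => /eqP->;
by case/orP: (lin_involution beta_lin Ru sqr_u) => /eqP->; rewrite ?eqxx ?opprK.
Qed.

Lemma split_suM : beta (s * u)%g = (-1)%R.
Proof.
have [Rs Ru] := gens_in_R; rewrite lin_charM // split_u mulrN.
by case/orP: (lin_involution beta_lin Rs sqr_s) => /eqP->;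
  rewrite ?mulr1 ?mulrNN ?mulr1.
Qed.

(* As s and u are conjugate in W, their contributions cancel. *)
Lemma cfdot_Ind_split psi :
  '[psi, 'Ind[W] beta]%R = ((psi 1%g - psi (s * u)%g) / 4%:R)%R.
Proof.
have [Rs Ru] := gens_in_R.
rewrite -cfdot_Res_l cfdotE card_R sum_R !cfResE ?subRW ?groupM ?group1 //.
rewrite cfun_su (lin_char1 beta_lin) split_u split_suM rmorphN /= mulrN
  rmorphN1 mulrN1.
by rewrite rmorph1 mulr1 addrK mulrC.
Qed.

End SplitCharacter.

Variable alpha : 'CF(R).
Hypotheses (alpha_lin : alpha \is a linear_char).
Hypotheses (alpha_s : alpha s = 1%R) (alpha_u : alpha u = (-1)%R).

Local Notation C := ('Ind[W] alpha).

Lemma one_neqN1 : (1 == -1 :> algC)%R = false.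
Proof. by rewrite eq_sym eqNr oner_eq0. Qed.

Lemma alpha_su : alpha s != alpha u.
Proof. by rewrite alpha_s alpha_u one_neqN1. Qed.

(** The formula of [cfdot_Ind_split] does not mention the character, so any linear character of [R]
    that separates s from u induces C. *)
Lemma Ind_split (beta : 'CF(R)) :
  beta \is a linear_char -> beta s != beta u -> 'Ind[W] beta = C.
Proof.
move=> beta_lin beta_su; apply: cfdot_inj => psi.
by rewrite !cfdot_Ind_split // alpha_su.
Qed.

(** Multiplying alpha by omega changes both signs and still separates s from u. Hence C vanishes on
    odd elements. *)
Lemma C_omega : (C * omega = C)%R.
Proof.
have [Rs Ru] := gens_in_R; have [Ss _ Su] := gens_in_S.
rewrite -cfIndM ?subRW //; apply: Ind_split.
  by rewrite rpredM ?cfRes_lin_char ?omega_lin.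
by rewrite !cfunE !cfResE ?subRW // !omega_gen // !mulrN1 eqr_opp alpha_su.
Qed.

Lemma C_odd g : g \in W -> g \notin N -> C g = 0%R.
Proof.
move=> Wg; rewrite notin_kerE // => /eqP om_g.
by have /cfunP/(_ g) := C_omega; rewrite cfunE om_g mulrN1 => /eqP;
  rewrite eqNr => /eqP.
Qed.

Lemma C_1 : C 1%g = 30%:R%R.
Proof.
by rewrite cfInd1 ?subRW // lin_char1 // mulr1 -divgS ?subRW // card_W card_R.
Qed.

Lemma C_noninvol g : g * g != 1 -> C g = 0%R.
Proof.
move=> gg; rewrite cfIndE ?subRW // big1 ?mulr0 // => y Wy.
apply/cfun0; apply: contra gg => /R_invol/eqP; rewrite -conjMg.
by rewrite (can2_eq (conjgK y) (conjgKV y)) conj1g.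
Qed.

(** The even elements of [R] are 1 and s u, so a conjugate of s u lies in [R] only when it is s u
    itself; this happens for the 8 elements of the centraliser, each contributing -1, and the sum is
    divided by 4. *)
Lemma C_su : C (s * u)%g = (- 2%:R)%R.
Proof.
have [Ss _ Su] := gens_in_S; have [_ _ Nsu] := ker_gens.
rewrite cfIndE ?subRW // card_R.
rewrite (eq_bigr (fun y => - (((s * u) ^ y)%g == (s * u)%g)%:R)%R) => [|y Wy].
  rewrite sumrN -natr_sum -big_mkcondr sum1dep_card.
  rewrite (_ : #|_| = 8%N) ?mulrN; last first.
    rewrite -card_cent_su; apply: eq_card => y;
      rewrite [in LHS]inE in_setI cent1E.
    by rewrite conjgE (can2_eq (mulKVg _) (mulKg _)) eq_sym.
  by congr (- _)%R; apply: canLR (mulKf _) _; rewrite -?natrM ?pnatr_eq0.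
case: eqP => [-> | neq]; first by rewrite split_suM ?alpha_su.
rewrite oppr0; apply/cfun0/negP=> Rsu; case: neq.
have: (s * u) ^ y \in R :&: N.
  by rewrite in_setI Rsu memJ_norm // (subsetP (cfker_norm omega)).
rewrite dihedral_ker // => /cyclePmin[k]; rewrite m_su; case: k => [|[|]] // _.
by rewrite expg0 => /eqP; rewrite conjg_eq1 => /eqP e; have := m_su;
  rewrite e order1.
Qed.

(** * Conjugacy classes and the two expressions of Gamma *)

Definition even_reps := [:: 1; s * u; t * u; s * t; (s * t) ^+ 2].
Definition class_reps := even_reps ++ [seq w0 * x | x <- even_reps].

Lemma even_reps_ker x : x \in even_reps -> x \in N.
Proof.
have [Nst Ntu Nsu] := ker_gens.
by move: x; apply/allP; rewrite /= group1 Nst Ntu Nsu groupX.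
Qed.

Lemma ker_W x : x \in N -> x \in W.
Proof. by apply/subsetP/cfker_sub. Qed.

Lemma class_reps_W x : x \in class_reps -> x \in W.
Proof.
rewrite mem_cat => /orP[/even_reps_ker/ker_W // | /mapP[y /even_reps_ker/ker_W
  Wy ->]].
by rewrite groupM ?w0W.
Qed.

Lemma uniq_even_classes : uniq [seq x ^: W | x <- even_reps].
Proof.
have neq_ord x y : #[x] != #[y] -> x ^: W != y ^: W.
  apply: contraNneq => eq_xy; have: x \in y ^: W by rewrite -eq_xy class_refl.
  by case/imsetP=> z _ ->; rewrite orderJ.
have neq_st2 : (s * t) ^: W != ((s * t) ^+ 2) ^: W.
  apply/eqP=> eq_cl; have: (s * t) ^+ 2 \in (s * t) ^: W by rewrite eq_cl
    class_refl.
  by case/imsetP=> z Wz e; have := st_conj_neq Wz; rewrite e eqxx.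
by rewrite /= !inE !negb_or neq_st2 !neq_ord ?order1 ?m_su ?m_tu ?m_st
  ?order_st2.
Qed.

(** Multiplication by the central element [w0] carries distinct classes to distinct classes, and its
    oddness separates the two halves of the list. *)
Lemma uniq_classes : uniq [seq x ^: W | x <- class_reps].
Proof.
rewrite map_cat cat_uniq uniq_even_classes -map_comp andTb; apply/andP; split.
  apply/hasPn=> _ /mapP[x /even_reps_ker Nx ->];
    apply/mapP=> -[y /even_reps_ker Ny] /= eq_xy.
  have: w0 * x \in y ^: W by rewrite -eq_xy class_refl.
  case/imsetP=> z Wz e.
  have: w0 * x \in N by rewrite e memJ_norm // (subsetP (cfker_norm omega)).
  by rewrite groupMr // (negPf w0_notin).
rewrite map_inj_in_uniq ?(map_uniq uniq_even_classes) // => x y ex ey /= eq_xy.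
apply: (uniq_map_inj uniq_even_classes ex ey).
have: w0 * x \in (w0 * y) ^: W by rewrite -eq_xy class_refl.
case/imsetP=> z Wz; rewrite conjMg (_ : w0 ^ z = w0) => [/mulgI-> | ];
  first exact: classGidl.
by rewrite conjgE (w0_central Wz) mulKg.
Qed.

Lemma classes_sub : {subset [seq x ^: W | x <- class_reps] <= enum (classes W)}.
Proof. by move=> _ /mapP[x /class_reps_W Wx ->];
  rewrite mem_enum mem_classes. Qed.

Lemma card_classes_ge : (10 <= #|classes W|)%N.
Proof. by rewrite cardE; apply: leq_trans (uniq_leq_size uniq_classes
  classes_sub). Qed.

Lemma C_char : C \is a character.
Proof. by rewrite cfInd_char ?lin_charW. Qed.

Lemma lin_1_omega (xi : 'CF(W)) : xi \is a linear_char -> xi = 1%R \/ xi =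
  omega.
Proof.
move=> xi_lin; have [d Wd tE] := conj_st; have [Ss _ _] := gens_in_S.
have xiS x : x \in S -> xi x = xi s.
  by rewrite mem_S => /or3P[]/eqP->; rewrite ?cfun_su // tE cfunJ.
have defW : W :=: <<S>> by case: coxWS.
case/orP: (lin_involution xi_lin sW sqr_s) => /eqP xi_s; [left | right];
  apply: (lin_char_gen_eq defW) => // [|x Sx];
    rewrite ?cfun1_lin_char ?omega_lin //.
  by rewrite xiS // xi_s cfun1E (subsetP S_sub).
by rewrite xiS // xi_s omega_gen.
Qed.

Lemma irr_C_occurs i : 'chi[W]_i != 1%R -> 'chi[W]_i != omega ->
  '['chi_i, C]%R != 0%R.
Proof.
move=> chi1 chi_om; rewrite cfdot_Ind_split ?alpha_su // mulf_eq0 invr_eq0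
  pnatr_eq0 orbF.
rewrite subr_eq0 eq_sym; apply/negP=> chi_su.
suffices: 'chi_i \is a linear_char.
  by case/lin_1_omega=> /eqP; rewrite ?(negPf chi1) ?(negPf chi_om).
have ker_su : s * u \in cfker 'chi_i by rewrite cfkerEirr inE.
pose L := cfker_group 'chi_i.
have nLW : W \subset 'N(L) := cfker_norm _.
have sS : s \in 'N(L) by rewrite (subsetP nLW) ?sW.
have tN : t \in 'N(L) by rewrite (subsetP nLW) ?tW.
have uN : u \in 'N(L) by rewrite (subsetP nLW) ?uW.
pose a := coset L s; pose b := coset L t.
have aa : a * a = 1 by rewrite -morphM // sqr_s morph1.
have bb : b * b = 1 by rewrite -morphM // sqr_t morph1.
have ua : coset L u = a.
  by apply: (mulgI a); rewrite aa -[a * _](morphM (coset_morphism L)) //=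
    coset_id.
have ab5 : (a * b) ^+ 5 = 1 by rewrite -morphM // -morphX ?groupM // -m_st
  expg_order morph1.
have ab3 : (a * b) ^+ 3 = 1.
  apply: expg_mul_invol => //; rewrite -[a]ua -morphM // -morphX ?groupM //.
  by rewrite -m_tu expg_order morph1.
(* The sixth power of [a * b] equals [a * b] by the relation of exponent 5 and equals 1 by that of
   exponent 3. *)
have ab : a * b = 1.
  by rewrite -[LHS]mul1g -ab5 -expgSr -[6%N]/(3 * 2)%N expgM ab3 expg1n.
have ba : b = a by apply: (mulgI a); rewrite ab aa.
have cosetS x : x \in S -> coset L x = a.
  by rewrite mem_S => /or3P[]/eqP->.
rewrite lin_irr_der1 der1_min //.
apply: (@abelianS _ _ <[a]>); last exact: cycle_abelian.
have sWS : W \subset <<S>> by have [defW _ _] := coxWS; rewrite {1}defW.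
apply: subset_trans (quotientS L sWS) _.
rewrite quotient_gen ?gen_subG ?(subset_trans S_sub nLW) //.
by apply/subsetP=> _ /morphimP[x _ Sx ->]; rewrite /= cosetS ?cycle_id.
Qed.

Local Notation Gamma := (\sum_i 'chi[W]_i)%R.

Lemma omega_irr : exists j, omega = 'chi[W]_j.
Proof.
by have /lin_char_irr/irrP[j ->] := omega_lin; exists j.
Qed.

Lemma omega_neq1 : omega != 1%R.
Proof.
have [Ss _ _] := gens_in_S; apply/eqP=> om1; have := omega_gen Ss.
by rewrite om1 cfun1E sW => /eqP; rewrite one_neqN1.
Qed.

Lemma cfdot_1_omega : [/\ '[1, omega]_W = 0, '[omega, 1]_W = 0 & '[omega]_W =
  1]%R.
Proof.
have [j omE] := omega_irr; have j0 : (j == 0) = false.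
  by apply: contraNF omega_neq1 => /eqP j0; rewrite omE j0 irr0.
by rewrite omE -irr0 !cfdot_irr eqxx j0 eq_sym j0.
Qed.

(** Every irreducible has multiplicity at least 1 in X, and the squares of the multiplicities sum to
    10. With at least 10 classes, equality holds throughout: there are exactly 10 irreducibles and
    each occurs once. *)
Lemma Gamma_classes : Gamma = (C + 1 + omega)%R /\ #|classes W| = 10%N.
Proof.
pose X : 'CF(W) := (C + 1 + omega)%R.
have [dot1o doto1 nrmo] := cfdot_1_omega; have [_ _ Nsu] := ker_gens.
have X_char : X \is a character by rewrite !rpredD ?C_char ?rpred1 ?lin_charW
  ?omega_lin.
have [m mE] : exists m : Iirr W -> nat, forall i, '[X, 'chi_i]%R = (m i)%:R%R.
  exists (fun i => Num.truncn '[X, 'chi_i]%R) => i.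
  by apply/esym/eqP; rewrite -natrEtruncn Cnat_cfdot_char_irr.
have m_gt0 i : (1 <= m i ^ 2)%N.
  rewrite expn_gt0 orbF lt0n -(pnatr_eq0 algC) -mE.
  have dot_ge0 (phi psi : 'CF(W)) : phi \is a character -> psi \is a character
    ->
      (0 <= '[phi, psi])%R by move=> ch1 ch2; rewrite natr_ge0 ?Cnat_cfdot_char.
  rewrite !cfdotDl gt_eqF //.
  have [chi1 | chi1] := eqVneq 'chi_i 1%R.
    rewrite chi1 cfnorm1 doto1 addr0 ltr_wpDl ?ltr01 // dot_ge0 ?C_char ?rpred1
      //.
  have [chi_om | chi_om] := eqVneq 'chi_i omega.
    rewrite chi_om nrmo dot1o addr0 ltr_wpDl ?ltr01 // dot_ge0 ?C_char
      ?lin_charW ?omega_lin //.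
  rewrite -addrA ltr_wpDr ?addr_ge0 ?dot_ge0 ?irr_char ?rpred1 ?lin_charW
    ?omega_lin //.
  rewrite lt_def dot_ge0 ?irr_char ?C_char // andbT -conjC_eq0 -cfdotC.
  exact: irr_C_occurs.
have om_su : omega (s * u)%g = 1%R by apply/eqP; rewrite -mem_kerE ?ker_W.
(* The inner product with C is (32 - 0) / 4 = 8, and those with 1 and omega are 1 each. *)
have normX : ('[X] = 10%:R)%R.
  have X1 : X 1%g = 32%:R%R by rewrite !cfunE C_1 cfun1E group1 omega1 -(natrD
    _ 30 1) -(natrD _ 31 1).
  have Xsu : X (s * u)%g = 0%R.
    by rewrite !cfunE C_su cfun1E ker_W // om_su -addrA -(natrD _ 1 1) addNr.
  have C1 : ('[C, 1] = 0)%R.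
    rewrite cfdotC cfdot_Ind_split ?alpha_su // !cfun1E group1 ker_W //.
    by rewrite subrr mul0r conjC0.
  have Com : ('[C, omega] = 0)%R.
    rewrite cfdotC cfdot_Ind_split ?alpha_su // omega1 om_su.
    by rewrite subrr mul0r conjC0.
  rewrite {2}/X !cfdotDr cfdot_Ind_split ?alpha_su // X1 Xsu subr0 !cfdotDl.
  rewrite C1 Com dot1o doto1 nrmo cfnorm1 !addr0 !add0r.
  by rewrite (_ : 32 = 8 * 4)%N // natrM mulfK ?pnatr_eq0 // -(natrD _ 8 1)
    -(natrD _ 9 1).
have sum_m : (\sum_i m i ^ 2 = 10)%N.
  apply/eqP; rewrite -(eqr_nat algC) natr_sum -normX cfdot_sum_irr;
    apply/eqP/eq_bigr => i _.
  by rewrite mE rmorph_nat natrX expr2.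
have sum1 : (\sum_(i : Iirr W) 1 = #|classes W|)%N.
  by rewrite sum1_card card_ord NirrE.
have := leqif_sum (fun i (_ : predT i) => leqif_eq (m_gt0 i)).
rewrite sum1 sum_m => -[le10]; rewrite eqn_leq le10 card_classes_ge =>
  /esym/forallP m2.
split; last by apply/eqP; rewrite eqn_leq le10 card_classes_ge.
rewrite -/X [X]cfun_sum_cfdot; apply: eq_bigr => i _; rewrite mE.
suffices ->: (m i = 1)%N by rewrite scale1r.
by have /eqP := m2 i; case: (m i) => [|[|k]].
Qed.

Lemma GammaE : Gamma = (C + 1 + omega)%R.
Proof. by case: Gamma_classes. Qed.

Lemma class_repsP g : g \in W -> exists2 x, x \in class_reps & exists2 y, y \in
  W & g = x ^ y.
Proof.
have [|_ eq_cl] := uniq_min_size uniq_classes classes_sub.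
  by rewrite -cardE; have [_ ->] := Gamma_classes.
move=> Wg; have /mapP[x rx gx]: g ^: W \in [seq x ^: W | x <- class_reps].
  by rewrite eq_cl mem_enum mem_classes.
exists x => //; have: g \in x ^: W by rewrite -gx class_refl.
by case/imsetP=> y Wy ->; exists y.
Qed.

Lemma ker_repsP g : g \in N -> exists2 x, x \in even_reps & exists2 y, y \in W
  & g = x ^ y.
Proof.
move=> Ng; have [x rx [y Wy gE]] := class_repsP (ker_W Ng); exists x;
  last by exists y.
move: rx; rewrite mem_cat => /orP[// | /mapP[z /even_reps_ker Nz xE]].
have: w0 * z \in N by rewrite -xE -(memJ_norm x (subsetP (cfker_norm omega) y
  Wy)) -gE.
by rewrite groupMr // (negPf w0_notin).
Qed.

Lemma Gamma_odd g : g \in W -> g \notin N -> Gamma g = 0%R.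
Proof.
move=> Wg Ng; rewrite GammaE !cfunE C_odd // cfun1E Wg add0r.
by move: Ng; rewrite notin_kerE // => /eqP->; rewrite subrr.
Qed.

Lemma Gamma_even g : g \in N -> Gamma g = (C g + 2%:R)%R.
Proof.
move=> Ng; have Wg := ker_W Ng; rewrite GammaE !cfunE cfun1E Wg -addrA;
  congr (_ + _)%R.
by move: Ng; rewrite mem_kerE // => /eqP->.
Qed.

(** On odd elements both sides vanish. On the five even representatives, A + B and C + 2 take the
    common values 32, 0, 2, 2, 2. *)
Lemma GammaAB : Gamma = (A + omega * B)%R.
Proof.
have [Ss St Su] := gens_in_S; have [Nst Ntu Nsu] := ker_gens.
have sqE (x : gT) : (x * x = x ^+ 2)%g by rewrite expgS expg1.
apply/cfun_inP=> g Wg; case: (boolP (g \in N)) => Ng; last first.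
  rewrite Gamma_odd // !cfunE AB_odd //.
  by move: Ng; rewrite notin_kerE // => /eqP->; rewrite mulN1r subrr.
rewrite Gamma_even // !cfunE; have /eqP->: omega g == 1%R by rewrite -mem_kerE.
rewrite mul1r; have [x rx [y Wy ->]] := ker_repsP Ng;
  rewrite !cfunJ // {g y Wy Wg Ng}.
have st2_ninv: (s * t) ^+ 2 * (s * t) ^+ 2 != 1.
  by rewrite -expgD -order_dvdn m_st.
have st_ninv: (s * t) * (s * t) != 1.
  by rewrite sqE -order_dvdn m_st.
have tu_ninv: (t * u) * (t * u) != 1.
  by rewrite sqE -order_dvdn m_tu.
move: rx; rewrite !inE => /or4P[|||/orP[]] /eqP->.
- by rewrite C_1 A_1 B_1 -!natrD.
- by rewrite C_su !Ind_dihedral_eq0 ?m_su ?m_st ?m_tu // addNr addr0.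
- by rewrite C_noninvol // B_tu Ind_dihedral_eq0 ?m_st ?m_tu.
- by rewrite C_noninvol // A_st Ind_dihedral_eq0 ?m_st ?m_tu // addrC.
by rewrite C_noninvol // A_st2 Ind_dihedral_eq0 ?order_st2 ?m_tu ?groupX //
  addrC.
Qed.

(** * Recognising conjugates of the dihedral parabolic subgroups *)

Lemma Ind1_conj (H : {group gT}) g : H \subset W -> g \in W ->
  'Ind[W, (H :^ g)%G] 1%R = 'Ind[W, H] 1%R.
Proof.
move=> sHW Wg; have sHgW : H :^ g \subset W by rewrite conj_subG.
apply/cfun_inP=> h Wh; rewrite !Ind1E // cardJg; congr (_%:R / _)%R.
rewrite -[RHS](card_rcoset _ g); apply: eq_card => y.
by rewrite mem_rcoset [in LHS]inE [in RHS]inE conjgM (groupMr y (groupVr Wg))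
  mem_conjg.
Qed.

(* Up to conjugation H :&: N is <xy>.  An involution y' of H is then odd and   *)
(* normalises <xy>; it cannot centralise xy, as 'C_W[xy] = <xy> * <w0>, hence  *)
(* it inverts xy, and x y' is even and centralises xy.                         *)
Lemma dihedral_subgroup x y (H : {group gT}) : x \in S -> y \in S ->
    prime #[x * y] -> odd #[x * y] -> (#|W|`_#[x * y] = #[x * y])%N ->
    #|'C_W[x * y]| = (2 * #[x * y])%N ->
    H \subset W -> ~~ (H \subset N) -> #|H :&: N| = #[x * y] -> w0 \notin H ->
  exists2 g, g \in W & H :=: <<[set x; y]>> :^ g.
Proof.
set r := x * y => Sx Sy; set p := #[r] => p_pr odd_p p_part cardC sHW nHN
  cardHN nw0.
have [Wx Wy] := (subsetP S_sub x Sx, subsetP S_sub y Sy);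
  have Wr : r \in W by rewrite groupM.
have Nr : r \in N by rewrite odd_mul_ker ?S_notin_ker.
have sylr : p.-Sylow(W) <[r]>.
  by rewrite pHallE cycle_subG Wr -orderE p_part eqxx.
have sylHN : p.-Sylow(W) (H :&: N).
  by rewrite pHallE subIset ?sHW //= cardHN p_part.
have [g Wg HNg] := Sylow_trans sylr sylHN; exists g => //.
pose H' := (H :^ g^-1)%G.
have sH'W : H' \subset W by rewrite conj_subG ?groupV.
have H'N : H' :&: N = <[r]>.
  have nNg : g^-1 \in 'N(N) by rewrite groupV (subsetP (cfker_norm omega)).
  by rewrite /= -{1}(normP nNg) -conjIg HNg conjsgK.
suffices defH' : H' :=: <<[set x; y]>> by rewrite -defH' /= conjsgKV.
have nw0' : w0 \notin H'.
  by rewrite /= mem_conjg invgK conjgE (w0_central Wg) mulKg.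
have cardH' : #|H'| = (2 * p)%N by rewrite /= cardJg card_odd // cardHN.
have CN z : z \in W -> z \in N -> commute z r -> z \in <[r]>.
  move=> Wz Nz czr.
  have nCN : ~~ ('C_W[r] \subset N).
    apply/subsetPn; exists w0; last exact: w0_notin.
    by rewrite in_setI w0W; apply/cent1P/w0_central.
  have cardCN : #|'C_W[r] :&: N| = p.
    have := card_odd (subsetIl _ _) nCN; rewrite cardC => /eqP.
    by rewrite eqn_pmul2l // => /eqP.
  have /eqP-> : <[r]> == 'C_W[r] :&: N.
    rewrite eqEcard cardCN -orderE leqnn andbT cycle_subG !in_setI Wr Nr !andbT.
    exact: cent1id.
  by rewrite !in_setI Wz Nz andbT; apply/cent1P.
have [y' H'y' ord_y'] : {y' | y' \in H' & #[y'] = 2%N}.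
  by apply: Cauchy; rewrite // cardH' dvdn_mulr.
have Wy' := subsetP sH'W y' H'y'.
have y'y' : y' * y' = 1 by have := expg_order y'; rewrite ord_y' expgS expg1.
have invol1 z : z * z = 1 -> z \in <[r]> -> z = 1.
  move=> zz rz; apply/eqP; rewrite -order_eq1 -dvdn1.
  have /eqP<- : coprime 2 p by rewrite coprime2n.
  by rewrite dvdn_gcd order_dvdn expgS expg1 zz eqxx order_dvdG.
have Ny' : y' \notin N.
  apply/negP=> Ny'; have := invol1 y' y'y';
    rewrite -H'N in_setI H'y' Ny' => /(_ isT) y'1.
  by move: ord_y'; rewrite y'1 order1.
have nr : r ^ y' \in <[r]>.
  have [H'r _] : r \in H' /\ r \in N by apply/setIP; rewrite H'N cycle_id.
  rewrite -H'N in_setI groupJ //= memJ_norm // (subsetP (cfker_norm omega)) //.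
have [k _ rk] := cyclePmin nr.
(* As y' squares to 1, the square of k is 1 modulo p, and p being prime, k is 1 or -1: y'
   centralises or inverts r. *)
have : r ^+ (k * k) == r ^+ 1.
  by rewrite expgM -rk -conjXg -rk -conjgM y'y' conjg1.
have k_gt0 : (0 < k)%N.
  rewrite lt0n; apply: contraTneq (prime_gt1 p_pr) => k0.
  move: rk; rewrite k0 expg0 => /eqP; rewrite conjg_eq1 => /eqP r1.
  by rewrite /p r1 order1.
rewrite eq_expg_mod_order eqn_mod_dvd ?muln_gt0 ?k_gt0 //.
rewrite -/p (_ : k * k - 1 = (k - 1) * (k + 1))%N; last first.
  by rewrite -(exp1n 2) -subn_sqr mulnn.
rewrite Euclid_dvdM // => /orP[] dv.
  have y'r : r ^ y' = r.
    rewrite rk -(subnK k_gt0) expgD expg1; move: dv;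
      rewrite order_dvdn => /eqP->.
    exact: mul1g.
  (* In the centralising case y' w0 lies in the group of r, of odd order, and squares to 1; it is
     therefore trivial, which would put w0 into H'. *)
  have zz : (y' * w0) * (y' * w0) = 1.
    by rewrite -mulgA (mulgA w0) (w0_central Wy') -(mulgA y') sqr_w0 mulg1.
  suffices rz : y' * w0 \in <[r]>.
    by case/negP: nw0'; rewrite -[w0](mulKg y') (invol1 _ zz rz) mulg1 groupV.
  have Ny'w0 : y' * w0 \in N by apply: odd_mul_ker; rewrite ?w0W ?w0_notin.
  apply: (CN _ (groupM Wy' w0W) Ny'w0).
  by rewrite /commute -mulgA (w0_central Wr) (mulgA y' r) (mulgA r) (conjgC r)
    y'r.
have rVx : r ^ x = r^-1.
  by rewrite conjgE /r !mulgA mulVg mul1g invMg !involV ?sqr_S.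
have rVy' : r ^ y' = r^-1.
  by apply: (mulIg r); rewrite mulVg rk -expgSr -addn1; apply/eqP;
    rewrite -order_dvdn.
have xy'r : x * y' \in <[r]>.
  have Nxy' : x * y' \in N by apply: odd_mul_ker => //; apply: S_notin_ker.
  apply: (CN _ (groupM Wx Wy') Nxy').
  by rewrite /commute (conjgC r (x * y')) conjgM rVx conjVg rVy' invgK.
have sCD : <[r]> \subset <<[set x; y]>>.
  by rewrite cycle_subG groupM ?mem_gen ?set21 ?set22.
have Dy' : y' \in <<[set x; y]>>.
  have xD : x \in <<[set x; y]>> by rewrite mem_gen ?set21.
  by rewrite -(groupMl y' xD) (subsetP sCD).
apply/eqP; rewrite eqEcard cardH' card_dihedral // leqnn andbT.
apply/subsetP=> z H'z; have Wz := subsetP sH'W z H'z;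
  case: (boolP (z \in N)) => Nz.
  by rewrite (subsetP sCD) // -H'N in_setI H'z.
by rewrite -(groupMr z Dy') (subsetP sCD) // -H'N in_setI groupM //=
  odd_mul_ker.
Qed.

(** * Allowed characters of small degree *)

Lemma Ind_Res (H : {group gT}) (xi : 'CF(W)) : H \subset W ->
  ('Ind[W] ('Res[H] xi) = 'Ind[W, H] 1 * xi)%R.
Proof. by move=> sHW; rewrite -cfIndM // mul1r. Qed.

Lemma lin_odd_eq (G : {group gT}) (xi : 'CF(G)) x y n :
    xi \is a linear_char -> x \in G -> y \in G -> x * x = 1 -> y * y = 1 ->
    odd n -> (x * y) ^+ n = 1 -> xi x = xi y.
Proof.
move=> xi_lin Gx Gy xx yy odd_n xyn.
have: (xi x * xi y = 1)%R.
  have [/eqP xiM | /eqP xiM] : xi (x * y)%g == 1%R \/ xi (x * y)%g == (-1)%R.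
  - rewrite lin_charM //.
    case/orP: (lin_involution xi_lin Gx xx) => /eqP->;
    case/orP: (lin_involution xi_lin Gy yy) => /eqP->;
    by rewrite ?mulrNN ?mulrN ?mulr1 ?mul1r eqxx; auto.
  - by rewrite -lin_charM.
  have := lin_charX xi_lin n (groupM Gx Gy);
    rewrite xyn lin_char1 // xiM -signr_odd odd_n => /eqP.
  by rewrite one_neqN1.
case/orP: (lin_involution xi_lin Gx xx) => /eqP->;
case/orP: (lin_involution xi_lin Gy yy) => /eqP->;
  rewrite ?mulrNN ?mulrN ?mulr1 ?mul1r // => /eqP;
by rewrite ?one_neqN1 // eq_sym one_neqN1.
Qed.

(** If t is in J, the odd relations make sigma constant on J, so sigma is the restriction of 1 or
    omega. If not, J lies in {s, u}, and the order of H forces J = {s, u} and H = [R]; then sigma is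
    again constant on J, or it separates s from u and induces C. *)
Lemma allowed_cases (chi : 'CF(W)) : allowed_character S chi ->
    (chi 1%g <= 32%:R)%R ->
  chi = C \/ exists (H : {group gT}) (xi : 'CF(W)),
    [/\ H \subset W, (4 <= #|H|)%N, xi = 1%R \/ xi = omega
      & chi = ('Ind[W, H] 1 * xi)%R].
Proof.
case=> J [H [sigma [sJS [sHJ _] sigma_lin ->]]].
have [Ss St Su] := gens_in_S.
have sJW : <<J>> \subset W by rewrite gen_subG (subset_trans sJS) ?S_sub.
have sHW := subset_trans sHJ sJW.
rewrite cfInd1 // cfRes1 lin_char1 // mulr1 ler_nat => le32.
(* The index of H is at most 32, and 3 * 32 < 120. *)
have H4 : (4 <= #|H|)%N.
  rewrite leqNgt; apply/negP=> H3; have: (120 <= 3 * 32)%N => //.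
  by rewrite -card_W -(Lagrange sHW) leq_mul.
have memJ x : x \in J -> x \in <<J>> by apply: mem_gen.
have const c : (c = 1 \/ c = -1)%R -> {in J, forall x, sigma x = c} ->
  'Ind[W] ('Res[H] sigma) = C \/ exists (H' : {group gT}) (xi : 'CF(W)),
    [/\ H' \subset W, (4 <= #|H'|)%N, xi = 1%R \/ xi = omega
      & 'Ind[W] ('Res[H] sigma) = ('Ind[W, H'] 1 * xi)%R].
  move=> c_sign sigmaJ; right; exists H.
  have [xi xi_eq sigmaE] : exists2 xi : 'CF(W), xi = 1%R \/ xi = omega & sigma
    = 'Res[<<J>>] xi.
    case: c_sign => cE; [exists 1%R; first by left | exists omega;
      first by right];
      apply: (lin_char_gen_eq (erefl _)) => //;
        rewrite ?cfRes_lin_char ?cfun1_lin_char ?omega_lin //.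
      by move=> x Jx; rewrite sigmaJ // rmorph1 cfun1E memJ.
    by move=> x Jx; rewrite sigmaJ // cfResE ?memJ // omega_gen // (subsetP
      sJS).
  by exists xi; split=> //; rewrite sigmaE cfResRes // Ind_Res.
have sign x : x \in J -> (sigma x = 1 \/ sigma x = -1)%R.
  move=> Jx; have := lin_involution sigma_lin (memJ x Jx) (sqr_S (subsetP sJS x
    Jx)).
  by case/orP=> /eqP; [left | right].
have [Jt | nJt] := boolP (t \in J).
  apply: (const (sigma t)) => [|x Jx]; first exact: sign.
  have := subsetP sJS x Jx; rewrite mem_S => /or3P[]/eqP xE;
    rewrite xE // in Jx *.
    apply: (lin_odd_eq (n := 5) sigma_lin); rewrite ?memJ ?sqr_s ?sqr_t //.
    by rewrite -m_st expg_order.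
  apply/esym/(lin_odd_eq (n := 3) sigma_lin); rewrite ?memJ ?sqr_u ?sqr_t //.
  by rewrite -m_tu expg_order.
have small x : x \in S -> J \subset [set x] -> False.
  move=> Sx sJx; have: (#|H| <= 2)%N.
    rewrite -(order_S Sx) orderE subset_leq_card // (subset_trans sHJ) //.
    by rewrite gen_subG (subset_trans sJx) // sub1set cycle_id.
  by rewrite leqNgt (leq_trans _ H4).
have sJsu x : x \in J -> x = s \/ x = u.
  move=> Jx; have := subsetP sJS x Jx; rewrite mem_S.
  by case/or3P=> /eqP xE; [left | move: nJt; rewrite -xE Jx | right].
have [Js | nJs] := boolP (s \in J); last first.
  case: (small u) => //; apply/subsetP=> x Jx; rewrite inE.
  by case: (sJsu x Jx) => xE; [rewrite -xE Jx in nJs | rewrite xE].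
have [Ju | nJu] := boolP (u \in J); last first.
  case: (small s) => //; apply/subsetP=> x Jx; rewrite inE.
  by case: (sJsu x Jx) => xE; [rewrite xE | rewrite -xE Jx in nJu].
have JE : J = [set s; u].
  apply/setP=> x; rewrite !inE; apply/idP/idP=> [/sJsu[]-> | /orP[]/eqP->] //;
    rewrite eqxx ?orbT //.
have [su_eq | su_neq] := eqVneq (sigma s) (sigma u).
  by apply: (const (sigma s)) => [|x /sJsu[]-> //]; apply: sign.
left; move: sigma sigma_lin su_neq sHJ {const sign memJ sJW};
  rewrite JE => sigma sigma_lin su_neq sHR.
have defH : H = R.
  by apply/val_inj/eqP; rewrite eqEcard sHR card_R.
by rewrite defH cfRes_id; apply: Ind_split.
Qed.

Lemma Gamma1 : Gamma 1%g = 32%:R%R.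
Proof. by rewrite Gamma_even ?group1 // C_1 -natrD. Qed.

Lemma allowed_char (chi : 'CF(W)) : allowed_character S chi ->
  chi \is a character /\ (1 <= chi 1%g)%R.
Proof.
case=> J [H [sigma [sJS [sHJ _] sigma_lin ->]]].
have sHW : H \subset W.
  by rewrite (subset_trans sHJ) // gen_subG (subset_trans sJS) ?S_sub.
rewrite cfInd_char ?cfRes_char ?lin_charW // cfInd1 // cfRes1 lin_char1 //
  mulr1.
by rewrite ler1n indexg_gt0.
Qed.

Lemma Gamma_irr j : ('[Gamma, 'chi_j] = 1)%R.
Proof.
rewrite cfdot_suml (bigD1 j) //= cfnorm_irr big1 ?addr0 // => i /negPf ij.
by rewrite cfdot_irr ij.
Qed.

(** Allowed characters have degree at least 1 and the total degree is 2, so there is a single term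
    or there are two linear ones. *)
Lemma sum_1_omega (F : seq 'CF(W)) : {in F, forall chi, allowed_character S
  chi} ->
  (\sum_(chi <- F) chi = 1 + omega)%R ->
  perm_eq F [:: 1%R; omega] \/ F = [:: (1 + omega)%R].
Proof.
move=> allF sumF; have chF x : x \in F -> (1 <= x 1%g)%R by
  case/allF/allowed_char.
have: ((size F)%:R <= 2%:R :> algC)%R.
  have -> : (2%:R = \sum_(chi <- F) chi 1%g :> algC)%R.
    by rewrite -sum_cfunE sumF !cfunE omega1 cfun1E group1.
  rewrite -sum1_size natr_sum !(big_seq_cond predT) /=.
  by apply: ler_sum => x; rewrite andbT; apply: chF.
rewrite ler_nat; case: F => [|x [|y [|z F]]] // in allF sumF chF *.
- move/cfunP/(_ 1%g): sumF; rewrite big_nil !cfunE omega1 cfun1E group1 -(natrD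
  _ 1 1).
  by move/eqP; rewrite eq_sym pnatr_eq0.
- by right; rewrite -sumF big_seq1.
left; have xF : x \in [:: x; y] by rewrite mem_head.
have yF : y \in [:: x; y] by rewrite !inE eqxx orbT.
rewrite big_cons big_seq1 in sumF.
have xy1 : (x 1%g + y 1%g = 2%:R)%R.
  by move/cfunP/(_ 1%g): sumF; rewrite !cfunE omega1 cfun1E group1 -(natrD _ 1
    1).
have [x_char x_ge1] := allowed_char (allF x xF).
have [y_char y_ge1] := allowed_char (allF y yF).
have x1 : x 1%g == 1%R.
  rewrite eq_le x_ge1 andbT -(lerD2r (y 1%g)) xy1 -[2%:R%R]/(1 + 1)%R lerD2l //.
have x_lin : x \is a linear_char by rewrite qualifE /= x_char.
case: (lin_1_omega x_lin) => xE; rewrite xE in sumF *.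
  by rewrite (addrI _ sumF).
rewrite addrC in sumF; rewrite (addIr _ sumF) -[_ :: _](cat1s omega) //.
by rewrite (perm_catC [:: omega] [:: 1%R]).
Qed.

(** * Models that do not contain C *)

Lemma Ind1_dot (H : {group gT}) (xi eta : 'CF(W)) : H \subset W ->
  ('['Ind[W, H] 1 * xi, eta] = '['Res[H] xi, 'Res[H] eta])%R.
Proof. by move=> sHW; rewrite -Ind_Res // Frobenius_reciprocity. Qed.

Lemma Res_omega (H : {group gT}) : H \subset W -> H \subset N -> ('Res[H] omega
  = 1)%R.
Proof.
move=> sHW sHN; apply/cfun_inP=> h Hh; rewrite cfResE // cfun1E Hh.
by apply/eqP; rewrite -mem_kerE (subsetP sHW, subsetP sHN).
Qed.

Lemma lin_norm (G : {group gT}) (xi : 'CF(G)) : xi \is a linear_char -> ('[xi]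
  = 1)%R.
Proof. by case/lin_char_irr/irrP=> i ->; rewrite cfnorm_irr. Qed.

Lemma Ind1_dot_ge0 (H : {group gT}) (xi eta : 'CF(W)) : H \subset W ->
    xi \is a linear_char -> eta \is a linear_char ->
  (0 <= '['Ind[W, H] 1 * xi, eta])%R.
Proof.
move=> sHW xi_lin eta_lin; rewrite Ind1_dot // natr_ge0 // Cnat_cfdot_char //.
  exact/lin_charW/cfRes_lin_char.
exact/lin_charW/cfRes_lin_char.
Qed.

Lemma Ind1_dot1 (H : {group gT}) (xi : 'CF(W)) : H \subset W ->
  xi \is a linear_char -> ('['Ind[W, H] 1 * xi, xi] = 1)%R.
Proof. by move=> sHW xi_lin; rewrite Ind1_dot // lin_norm // cfRes_lin_char.
  Qed.

Lemma Ind1_gt0 (H : {group gT}) g : H \subset W -> g \in H -> (0 < 'Ind[W, H] 1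
  g)%R.
Proof.
move=> sHW Hg; rewrite Ind1E // divr_gt0 ?ltr0n ?cardG_gt0 //.
by apply/card_gt0P; exists 1; rewrite inE group1 conjg1.
Qed.

Lemma Gamma_even_invol g : g \in N -> #[g] = 2%N -> Gamma g = 0%R.
Proof.
have [Ss St Su] := gens_in_S.
move=> Ng g2; rewrite GammaAB !cfunE !Ind_dihedral_eq0 ?g2 ?m_st ?m_tu //.
by rewrite mulr0 addr0.
Qed.

Lemma Gamma_dot_1_omega : ('[Gamma, 1] = 1 /\ '[Gamma, omega] = 1)%R.
Proof.
by have [j ->] := omega_irr; rewrite -irr0 !Gamma_irr.
Qed.

Lemma cfun1_omega_lin : (1%R : 'CF(W)) \is a linear_char /\ omega \is a
  linear_char.
Proof. by rewrite cfun1_lin_char omega_lin. Qed.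

(** By Cauchy's theorem the even part of H has odd order; that order divides 60 and is at least
    2. *)
Lemma card_involution_free (H : {group gT}) : H \subset W -> ~~ (H \subset N) ->
    (forall g, g \in H -> g \in N -> #[g] <> 2%N) -> (4 <= #|H|)%N ->
  [\/ #|H :&: N| = 3, #|H :&: N| = 5 | #|H :&: N| = 15]%N.
Proof.
move=> sHW nHN free; rewrite card_odd // => H4.
have odd_m : odd #|H :&: N|.
  rewrite -[odd _]negbK -dvdn2; apply/negP=> /(Cauchy (isT : prime 2))[g].
  by case/setIP=> Hg Ng /(free g Hg Ng).
have: #|H :&: N| \in divisors 60.
  by rewrite -dvdn_divisors // -(@dvdn_pmul2l 2) // -card_odd // -[(2 *
    60)%N]card_W cardSg.
have ok : all (fun m => odd m && (4 <= 2 * m)%N ==> (m \in [:: 3; 5;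
  15]%N)) (divisors 60).
  by vm_compute.
move/(allP ok); rewrite odd_m H4 /= !inE => /or3P[]/eqP->;
  by [constructor 1 | constructor 2 | constructor 3].
Qed.

(** Conjugation fixes the central element [w0], so either all the summands of the induced value are
    1 or all are 0. *)
Lemma Ind1_w0 (H : {group gT}) : H \subset W ->
  'Ind[W, H] 1%R w0 = (if w0 \in H then 120 %/ #|H| else 0)%N%:R%R.
Proof.
move=> sHW; have w0J y : y \in W -> w0 ^ y = w0.
  by move=> Wy; rewrite conjgE (w0_central Wy) mulKg.
case: ifP => w0H; rewrite cfIndE //.
  rewrite -(Ind1_index sHW) cfIndE //; congr (_ * _)%R; apply: eq_bigr => y Wy.
  by rewrite w0J // conj1g !cfun1E w0H group1.
by rewrite big1 ?mulr0 // => y Wy; rewrite w0J // cfun1E w0H.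
Qed.

Lemma Ind1_dihedral x y (H : {group gT}) : x \in S -> y \in S ->
    prime #[x * y] -> odd #[x * y] -> (#|W|`_#[x * y] = #[x * y])%N ->
    #|'C_W[x * y]| = (2 * #[x * y])%N ->
    H \subset W -> ~~ (H \subset N) -> #|H :&: N| = #[x * y] -> w0 \notin H ->
  'Ind[W, H] 1%R = 'Ind[W, <<[set x; y]>>%G] 1%R.
Proof.
move=> Sx Sy p_pr odd_p p_part cardC sHW nHN cardHN nw0.
have [g Wg defH] := dihedral_subgroup Sx Sy p_pr odd_p p_part cardC sHW nHN
  cardHN nw0.
have -> : H = (<<[set x; y]>> :^ g)%G by apply: val_inj.
by rewrite Ind1_conj // dihedral_sub.
Qed.

(** The even parts have order 3, 5 or 15, hence the degrees are among 20, 12 and 4; only 20 + 12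
    gives 32. *)
Lemma Ind1_pair (H1 H2 : {group gT}) : H1 \subset W -> H2 \subset W ->
    (4 <= #|H1|)%N -> (4 <= #|H2|)%N ->
    ('Ind[W, H1] 1 + 'Ind[W, H2] 1 * omega = Gamma)%R ->
  ('Ind[W, H1] 1 = A /\ 'Ind[W, H2] 1 = B)%R \/ ('Ind[W, H1] 1 = B /\ 'Ind[W,
    H2] 1 = A)%R.
Proof.
move=> sH1 sH2 H1_4 H2_4 sumG; have [Ss St Su] := gens_in_S.
have [lin1 lino] := cfun1_omega_lin; have [Gdot1 Gdoto] := Gamma_dot_1_omega.
(* Were H1 inside N, omega would restrict to 1 on it, and Gamma would contain omega twice, once from
   each term. *)
have nH1 : ~~ (H1 \subset N).
  apply/negP=> sH1N; move: Gdoto; rewrite -sumG cfdotDl (Ind1_dot1 sH2 lino).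
  rewrite -['Ind[W, H1] 1%R]mulr1 (Ind1_dot _ _ sH1) (Res_omega sH1 sH1N)
    rmorph1 cfnorm1.
  by move/eqP; rewrite -(natrD _ 1 1) (eqr_nat _ 2 1).
have nH2 : ~~ (H2 \subset N).
  apply/negP=> sH2N; move: Gdot1;
    rewrite -sumG cfdotDl -{1}['Ind[W, H1] 1%R]mulr1.
  rewrite (Ind1_dot1 sH1 lin1) (Ind1_dot _ _ sH2) (Res_omega sH2 sH2N) rmorph1
    cfnorm1.
  by move/eqP; rewrite -(natrD _ 1 1) (eqr_nat _ 2 1).
have even_val g : g \in N -> ('Ind[W, H1] 1 g + 'Ind[W, H2] 1 g = Gamma g)%R.
  by move=> Ng; rewrite -sumG !cfunE; have /eqP->: omega g == 1%R;
    rewrite -?mem_kerE ?ker_W ?mulr1.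
have free1 g : g \in H1 -> g \in N -> #[g] <> 2%N.
  move=> Hg Ng /(Gamma_even_invol Ng); rewrite -even_val //; apply/eqP.
  by rewrite gt_eqF // ltr_wpDr ?Ind1_ge0 ?Ind1_gt0.
have free2 g : g \in H2 -> g \in N -> #[g] <> 2%N.
  move=> Hg Ng /(Gamma_even_invol Ng); rewrite -even_val //; apply/eqP.
  by rewrite gt_eqF // ltr_wpDl ?Ind1_ge0 ?Ind1_gt0.
have deg : (120 %/ #|H1| + 120 %/ #|H2| = 32)%N.
  by apply/eqP; rewrite -(eqr_nat algC) natrD -!Ind1_index // even_val //
    Gamma1.
have [p3 p5] : (#|W|`_3 = 3 /\ #|W|`_5 = 5)%N by rewrite card_W !p_part.
(* Gamma vanishes at the odd element w0, where omega is -1. *)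
have w0_val : 'Ind[W, H1] 1%R w0 = 'Ind[W, H2] 1%R w0.
  apply/eqP; rewrite -subr_eq0 -mulrN1 -omega_w0 -(Gamma_odd w0W w0_notin)
    -sumG.
  by rewrite !cfunE.
have := card_involution_free sH1 nH1 free1 H1_4;
  have := card_involution_free sH2 nH2 free2 H2_4.
have cardH1 := card_odd sH1 nH1; have cardH2 := card_odd sH2 nH2.
rewrite cardH1 cardH2 in deg => m2 m1.
have {m1 m2} [[m1 m2] | [m1 m2]] : (#|H1 :&: N| = 3 /\ #|H2 :&: N| = 5 \/
                         #|H1 :&: N| = 5 /\ #|H2 :&: N| = 3)%N.
- by case: m1 => m1; case: m2 => m2; rewrite m1 m2 in deg *; auto.
- right; rewrite !Ind1_w0 // cardH1 cardH2 m1 m2 in w0_val.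
  (* The values at w0 are the index or 0; the indices 20 and 12 differ, so equality means that both
     values are 0. *)
  have [nw1 nw2] : w0 \notin H1 /\ w0 \notin H2.
    by move/eqP: w0_val; rewrite eqr_nat; case: (w0 \in H1); case: (w0 \in H2).
  by rewrite (@Ind1_dihedral t u H1) ?(@Ind1_dihedral s t H2) ?m_tu ?m_st
    ?card_cent_tu ?card_cent_st ?p3 ?p5.
left; rewrite !Ind1_w0 // cardH1 cardH2 m1 m2 in w0_val.
have [nw1 nw2] : w0 \notin H1 /\ w0 \notin H2.
  by move/eqP: w0_val; rewrite eqr_nat; case: (w0 \in H1); case: (w0 \in H2).
by rewrite (@Ind1_dihedral s t H1) ?(@Ind1_dihedral t u H2) ?m_tu ?m_st
  ?card_cent_tu ?card_cent_st ?p3 ?p5.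
Qed.

Lemma models_complete (F : seq 'CF(W)) : qp_gelfand_model S F ->
  [\/ perm_eq F [:: A; omega * B]%R, perm_eq F [:: omega * A; B]%R,
      perm_eq F [:: C; 1; omega]%R | perm_eq F [:: C; 1 + omega]%R].
Proof.
case=> allF sumF; have [lin1 lino] := cfun1_omega_lin.
have [FC | nFC] := boolP (C \in F).
  have permF := perm_to_rem FC.
  have allF' : {in rem C F, forall chi, allowed_character S chi}.
    by move=> chi /mem_rem; apply: allF.
  have sumF' : (\sum_(chi <- rem C F) chi = 1 + omega)%R.
    apply: (addrI C); rewrite addrA -GammaE -sumF (perm_big _ permF) big_cons
      //.
  case: (sum_1_omega allF' sumF') => [permF' | F'E];
    [constructor 3 | constructor 4].
    by rewrite (perm_trans permF) // perm_cons.
  by rewrite (perm_trans permF) // F'E.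
have le32 chi : chi \in F -> (chi 1%g <= 32%:R)%R.
  move=> Fchi; rewrite -Gamma1 -sumF sum_cfunE (perm_big _ (perm_to_rem Fchi))
    big_cons /=.
  rewrite lerDl big_seq sumr_ge0 // => x /mem_rem/allF/allowed_char[_ x1].
  exact: le_trans ler01 x1.
have form chi : chi \in F -> exists (H : {group gT}) (xi : 'CF(W)),
    [/\ H \subset W, (4 <= #|H|)%N, xi = 1%R \/ xi = omega
      & chi = ('Ind[W, H] 1 * xi)%R].
  move=> Fchi; have [chiC | //] := allowed_cases (allF _ Fchi) (le32 _ Fchi).
  by rewrite -chiC Fchi in nFC.
have xi_lin xi : xi = 1%R \/ xi = omega -> xi \is a linear_char by case=> ->.
have [Gdot1 Gdoto] := Gamma_dot_1_omega.
have dot_ge1 chi : chi \in F -> (1 <= '[chi, 1] + '[chi, omega])%R.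
  case/form=> H [xi [sHW _ xiE ->]].
  case: (xiE) => E; rewrite {1 2}E Ind1_dot1 //;
    [rewrite lerDl | rewrite lerDr].
    by rewrite Ind1_dot_ge0.
  by rewrite Ind1_dot_ge0.
have szF : (size F <= 2)%N.
  rewrite -(ler_nat algC) [leRHS](_ : _ = '[Gamma, 1] + '[Gamma, omega])%R;
    last first.
    by rewrite Gdot1 Gdoto -(natrD _ 1 1).
  rewrite -sumF !cfdot_suml -big_split /= -sum1_size natr_sum big_seq
    [leRHS]big_seq.
  by apply: ler_sum => x; apply: dot_ge1.
case: F => [|x [|y [|z F]]] // in sumF form szF {allF nFC le32 dot_ge1} *.
- move: Gamma1; rewrite -sumF big_nil cfunE => /eqP.
  by rewrite eq_sym pnatr_eq0.
(* A single term would give a subgroup of index 32, but 32 does not divide 120. *)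
- have [H [xi [sHW _ xiE xE]]] := form x (mem_head _ _).
  move: Gamma1; rewrite -sumF big_seq1 xE cfunE Ind1_index // (lin_char1
    (xi_lin _ xiE)) mulr1.
  move/eqP; rewrite eqr_nat => /eqP eq32.
  have := divnK (cardSg sHW); rewrite card_W eq32 => eq120.
  by have := dvdn_mulr #|H| (dvdnn 32); rewrite eq120.
have [H1 [xi1 [sH1 H1_4 xi1E xE]]] := form x (mem_head _ _).
have [H2 [xi2 [sH2 H2_4 xi2E yE]]] := form y (mem_last x [:: y]).
rewrite big_cons big_seq1 xE yE in sumF; rewrite {}xE {}yE {form szF}.
have two_neq1 : (1 + 1 != 1 :> algC)%R by rewrite -(natrD _ 1 1) (eqr_nat _ 2
  1).
case: xi1E => E1; case: xi2E => E2; rewrite {}E1 {}E2 in sumF *.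
(* Two terms with the same linear character would give it multiplicity 2 in Gamma; the last case is
   the same with omega. *)
- by case/eqP: two_neq1; rewrite -{3}Gdot1 -sumF cfdotDl !Ind1_dot1.
- rewrite mulr1 in sumF *.
  have [[-> ->] | [-> ->]] := Ind1_pair sH1 sH2 H1_4 H2_4 sumF.
    by constructor 1; rewrite mulrC.
  by constructor 2; rewrite mulrC (perm_catC [:: B] [:: _]).
- rewrite addrC mulr1 in sumF *.
  have [[-> ->] | [-> ->]] := Ind1_pair sH2 sH1 H2_4 H1_4 sumF.
    by constructor 1; rewrite mulrC (perm_catC [:: _] [:: A]).
  by constructor 2; rewrite mulrC.
by case/eqP: two_neq1; rewrite -{3}Gdoto -sumF cfdotDl !Ind1_dot1.
Qed.

(** * The four families are models *)

Lemma bigminn_ge (I : finType) m (Q : pred I) (F : I -> nat) c :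
  (c <= m -> (forall i, Q i -> c <= F i) -> c <= \big[minn/m]_(i | Q i) F i)%N.
Proof.
move=> le_cm le_cF; elim/big_rec: _ => // i k Qi le_ck.
by rewrite leq_min le_cF.
Qed.

Lemma cox_length_le w n : (n < #|gT|)%N -> w \in S ^+ n -> (cox_length S w <=
  n)%N.
Proof. by move=> lt_n Sw; apply: (bigminn_le _ _ (i := Ordinal lt_n)). Qed.

(** N contains 1 and the odd coset contains s but not 1. The bound on [#|gT|] keeps the lengths 0
    and 1 below the default value of the minima. *)
Lemma min_length_ker x : x \in W -> min_length S (x *: N) = (x \notin N) :> nat.
Proof.
move=> Wx; have gT120 : (120 <= #|gT|)%N by rewrite -card_W max_card.
apply/eqP; rewrite eqn_leq; apply/andP; split.
  have [Nx | Nx] := boolP (x \in N).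
    rewrite lcoset_id //; apply: leq_trans (bigminn_le _ _ (group1 _)) _.
    by apply: (@cox_length_le 1 0%N);
      [apply: leq_trans gT120 | rewrite expg0 inE].
  have [Ss _ _] := gens_in_S.
  have sxN : s \in x *: N.
    by rewrite mem_lcoset odd_mul_ker ?groupV ?sW ?(S_notin_ker Ss).
  apply: leq_trans (bigminn_le _ _ sxN) _.
  by apply: (@cox_length_le s 1%N); [apply: leq_trans gT120 | rewrite expg1].
have [// | Nx] := boolP (x \in N); apply: bigminn_ge => [|w].
  exact: leq_trans gT120.
rewrite mem_lcoset => Nxw; rewrite lt0n; apply/eqP=> w0l.
have Ww : w \in W by rewrite -(groupMl _ (groupVr Wx)) ker_W.
have := cox_length_mem Ww; rewrite w0l expg0 => /set1P w1.
by case/negP: Nx; rewrite -groupV -[x^-1]mulg1 -w1.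
Qed.

Lemma defW : W :=: <<S>>.
Proof. by case: coxWS. Qed.

(** There are two cosets, and every odd element exchanges them. A reflection therefore always
    changes the height, which makes QP1 vacuous, and acts as every simple generator does, which is
    the conclusion of QP2. *)
Lemma qp_ker : quasiparabolic_subgroup S S N.
Proof.
split; first by rewrite -defW cfker_sub.
have lc xN : xN \in lcosets N <<S>> -> exists2 x, x \in W & xN = x *: N.
  by case/lcosetsP=> x; rewrite -defW => Wx ->; exists x.
have mem_lc x : x \in W -> x *: N \in lcosets N <<S>>.
  by move=> Wx; apply/lcosetsP; exists x; rewrite -?defW.
have odd_refl r : r \in reflections <<S>>%G S -> r \in W /\ r \notin N.
  case/imset2P=> x y Sx; rewrite /= -defW => Wy ->.
  split; first by rewrite groupJ ?(subsetP S_sub x Sx).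
  by rewrite memJ_norm ?S_notin_ker // (subsetP (cfker_norm omega)).
have eq_odd v w x : v \in W -> w \in W -> x \in W -> v \notin N -> w \notin N ->
    v *: (x *: N) = w *: (x *: N).
  move=> Wv Ww Wx Nv Nw; rewrite -!lcosetM; apply/lcoset_eqP;
    rewrite mem_lcoset.
  rewrite invMg -mulgA (mulgA _ v) -conjgE memJ_norm ?(subsetP (cfker_norm
    omega)) //.
  by rewrite odd_mul_ker ?groupV.
have mem_odd v x : v \in W -> x \in W -> v \notin N -> (v * x \in N) = (x
  \notin N).
  move=> Wv Wx Nv; have [Nx | Nx] := boolP (x \in N);
    last by rewrite odd_mul_ker.
  by rewrite groupMr // (negPf Nv).
split.
- split; first split.
  + move=> w xN Ww /lc[x Wx ->]; rewrite /= -defW in Ww.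
    by rewrite -lcosetM mem_lc ?groupM.
  + by move=> xN _; rewrite lcoset1.
  + by move=> v w xN _ _ _; rewrite lcosetM.
  move=> r xN Sr /lc[x Wx ->]; have Wr := subsetP S_sub r Sr; rewrite -lcosetM.
  rewrite (min_length_ker (groupM Wr Wx)) (min_length_ker Wx).
  by do 2!case: (_ \notin N).
- move=> xN r /lc[x Wx ->] /odd_refl[Wr Nr]; rewrite -lcosetM.
  rewrite (min_length_ker (groupM Wr Wx)) (min_length_ker Wx) mem_odd // negbK.
  by case: (x \in N).
move=> xN r y /lc[x Wx ->] /odd_refl[Wr Nr] Sy _ _.
by apply: eq_odd; rewrite ?(S_notin_ker Sy) ?(subsetP S_sub y Sy).
Qed.

(** The set of cosets is a single point, on which everything acts trivially. *)
Lemma qp_parabolic (J : {set gT}) : J \subset S ->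
  quasiparabolic_subgroup S J <<J>>%G.
Proof.
move=> sJS; split=> //.
have lc X : X \in lcosets <<J>>%G <<J>> -> X = <<J>>.
  by case/lcosetsP=> x Jx ->; rewrite lcoset_id.
have act x X : x \in <<J>> -> X \in lcosets <<J>>%G <<J>> -> x *: X = X.
  by move=> Jx /lc->; rewrite lcoset_id.
have refl r : r \in reflections <<J>>%G J -> r \in <<J>>.
  by case/imset2P=> x y Jx Jy ->; rewrite groupJ ?(mem_gen Jx).
split.
- split; first split.
  + by move=> w X Jw XX; rewrite act.
  + by move=> X _; rewrite lcoset1.
  + by move=> v w X _ _ _; rewrite lcosetM.
  by move=> x X Jx XX; rewrite (act x X (mem_gen Jx) XX) subrr normr0.
- by move=> X r XX /refl Jr _; rewrite act.
by move=> X r x XX /refl Jr Jx _ _;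
  rewrite (act r X Jr XX) (act x X (mem_gen Jx) XX).
Qed.

Lemma allowed_parabolic (J : {set gT}) (sigma : 'CF(<<J>>)) : J \subset S ->
  sigma \is a linear_char -> allowed_character S ('Ind[W] sigma).
Proof.
move=> sJS sigma_lin; exists J, <<J>>%G, sigma; split=> //;
  first exact: qp_parabolic.
by rewrite cfRes_id.
Qed.

Lemma Ind_ker : 'Ind[W, cfker_group omega] 1%R = (1 + omega)%R.
Proof.
have nWN : ~~ (W \subset N) by apply/subsetPn; exists w0;
  rewrite ?w0W ?w0_notin.
have iN : #|W : N| = 2%N.
  rewrite -divgS ?cfker_sub // {1}(card_odd (subxx W) nWN).
  by rewrite (setIidPr (cfker_sub _)) mulnK ?cardG_gt0.
rewrite cfInd_cfun1 ?cfker_normal // iN; apply/cfun_inP=> g Wg.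
rewrite !cfunE cfuniE ?cfker_normal // cfun1E Wg;
  have [Ng | Ng] := boolP (g \in N).
  by move: Ng; rewrite mem_kerE // => /eqP->; rewrite mulr1.
by move: Ng; rewrite notin_kerE // => /eqP->; rewrite mulr0 subrr.
Qed.

Lemma allowed_Ind (J : {set gT}) (H : {group gT}) (xi : 'CF(W)) : J \subset S ->
    quasiparabolic_subgroup S J H -> xi \is a linear_char ->
  allowed_character S ('Ind[W, H] 1 * xi)%R.
Proof.
move=> sJS qpH xi_lin; have [sHJ _] := qpH.
have sJW : <<J>> \subset W by rewrite gen_subG (subset_trans sJS) ?S_sub.
exists J, H, ('Res[<<J>>] xi); split=> //; first exact: cfRes_lin_char.
by rewrite cfResRes // Ind_Res // (subset_trans sHJ).
Qed.

Lemma allowed_lin (xi : 'CF(W)) : xi \is a linear_char -> allowed_character S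
  xi.
Proof.
move=> xi_lin; have := allowed_Ind (subxx S) (qp_parabolic (subxx S)) xi_lin.
have -> : <<S>>%G = W by apply/val_inj; rewrite /= -defW.
by rewrite cfInd_id mul1r.
Qed.

Lemma models_sound (F : seq 'CF(W)) :
    has (perm_eq F) [:: [:: A; omega * B]; [:: omega * A; B]; [:: C; 1; omega];
                        [:: C; 'Ind[W, cfker_group omega] 1]]%R ->
  qp_gelfand_model S F.
Proof.
have perm_model G : qp_gelfand_model S G -> perm_eq F G -> qp_gelfand_model S F.
  case=> allG sumG permF; split; last by rewrite (perm_big _ permF).
  by move=> chi; rewrite (perm_mem permF); apply: allG.
have [Ss St Su] := gens_in_S; have [lin1 lino] := cfun1_omega_lin.
have sub2 x y : x \in S -> y \in S -> [set x; y] \subset S.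
  by move=> Sx Sy; rewrite subUset !sub1set Sx.
have allA xi : xi \is a linear_char -> allowed_character S (xi * A)%R.
  by rewrite mulrC; apply/allowed_Ind/qp_parabolic; apply: sub2.
have allB xi : xi \is a linear_char -> allowed_character S (xi * B)%R.
  by rewrite mulrC; apply/allowed_Ind/qp_parabolic; apply: sub2.
have allC : allowed_character S C by apply: allowed_parabolic => //;
  apply: sub2.
have omega2 : (omega * omega = 1)%R.
  apply/cfun_inP=> g Wg; rewrite cfunE cfun1E Wg.
  by case/orP: (omega_sign Wg) => /eqP->; rewrite ?mulrNN mulr1.
(* Multiplication by omega fixes C and exchanges 1 and omega; applied to A + omega B it gives the
   second family. *)
have omega_Gamma : (omega * Gamma = Gamma)%R.
  by rewrite GammaE !mulrDr mulr1 omega2 mulrC C_omega addrAC.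
case/hasP=> G; rewrite !inE => /or4P[] /eqP-> /perm_model; apply; split.
- move=> chi; rewrite !inE => /orP[]/eqP->; last exact: allB lino.
  by have := allA _ lin1; rewrite mul1r.
- by rewrite big_cons big_seq1 GammaAB.
- move=> chi; rewrite !inE => /orP[]/eqP->; first exact: allA lino.
  by have := allB _ lin1; rewrite mul1r.
- rewrite big_cons big_seq1 -omega_Gamma GammaAB mulrDr mulrA omega2 mul1r //.
- move=> chi; rewrite !inE => /or3P[]/eqP-> //; exact: allowed_lin.
- by rewrite !big_cons big_nil addr0 addrA GammaE.
- move=> chi; rewrite !inE => /orP[]/eqP-> //; rewrite -['Ind[W, _] _]mulr1.
  exact: allowed_Ind (subxx S) qp_ker lin1.
by rewrite big_cons big_seq1 Ind_ker addrA GammaE.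
Qed.

(** * The four families are distinct, and the conclusion *)

Lemma models_distinct :
  pairwise (fun F G => ~~ perm_eq F G)
    [:: [:: A; omega * B]; [:: omega * A; B]; [:: C; 1; omega];
        [:: C; 'Ind[W, cfker_group omega] 1]]%R.
Proof.
have neq1 (phi psi : 'CF(W)) : phi 1%g != psi 1%g -> phi != psi.
  by apply: contraNneq => ->.
(* A is positive at s, where omega is -1; the other comparisons use the lengths of the families or
   the degrees 12, 20 and 30. *)
have neqA : A != (omega * A)%R.
  apply/eqP=> /cfunP/(_ s); have [Ss St Su] := gens_in_S;
    rewrite cfunE omega_gen // mulN1r.
  move/eqP; rewrite eq_sym eqNr gt_eqF // Ind1_gt0 ?dihedral_sub //.
  by rewrite mem_gen ?set21.
have size_neq (F G : seq 'CF(W)) : size F != size G -> ~~ perm_eq F G.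
  by apply: contra => /perm_size->.
have mem_neq phi (F G : seq 'CF(W)) : phi \in F -> phi \notin G -> ~~ perm_eq F
  G.
  by move=> Fphi; apply: contra => /perm_mem <-.
have mem_neq' phi (F G : seq 'CF(W)) : phi \in G -> phi \notin F -> ~~ perm_eq
  F G.
  by move=> Fphi; apply: contra => /perm_mem ->.
rewrite /= !andbT; apply/and3P; split; [apply/and3P; split | apply/andP;
  split | ].
- apply: (mem_neq A); rewrite ?mem_head // !inE negb_or neqA neq1 // A_1 B_1
  eqr_nat //.
- exact: size_neq.
- apply: (mem_neq' C); rewrite ?mem_head // !inE negb_or !neq1 // ?cfunE C_1
  ?A_1 ?B_1 ?omega1 ?mul1r eqr_nat //.
- exact: size_neq.
- apply: (mem_neq' C); rewrite ?mem_head // !inE negb_or !neq1 // ?cfunE C_1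
  ?A_1 ?B_1 ?omega1 ?mul1r eqr_nat //.
exact: size_neq.
Qed.

End H3.

Local Open Scope ring_scope.

Theorem theorem6p5 (gT : finGroupType) (W : {group gT}) (s t u : gT)
  (S := [set s; t; u])
  (coxWS : coxeter_system W S)
  (m_st : #[s * t]%g = 5%N) (m_tu : #[t * u]%g = 3%N) (m_su : #[s * u]%g = 2%N)
  (omega : 'CF(W))
  (omegaE : {in W, forall w, omega w = (-1) ^+ cox_length S w})
  (alpha : 'CF(<<[set s; u]>>))
  (alpha_lin : alpha \is a linear_char)
  (alpha_s : alpha s = 1) (alpha_u : alpha u = -1)
  (A := 'Ind[W] (1 : 'CF(<<[set s; t]>>)))
  (B := 'Ind[W] (1 : 'CF(<<[set t; u]>>)))
  (C := 'Ind[W] alpha)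
  (D := 'Ind[W] (1 : 'CF(cfker omega)))
  (models := [:: [:: A; omega * B]; [:: omega * A; B];
                 [:: C; 1; omega]; [:: C; D]]) :
  [/\ D = 1 + omega,
      forall F : seq 'CF(W),
        qp_gelfand_model S F <-> has (perm_eq F) models
    & pairwise (fun F G => ~~ perm_eq F G) models].
Proof.
have DE : D = 1 + omega by apply: (Ind_ker coxWS m_st m_tu m_su omegaE).
split=> // [F|].
  split=> [qpF | modF]; last exact: (models_sound coxWS m_st m_tu m_su omegaE
    alpha_lin alpha_s alpha_u).
  have [] := models_complete coxWS m_st m_tu m_su omegaE alpha_lin alpha_s
    alpha_u qpF;
    by rewrite /models /= DE => ->; rewrite ?orbT.
exact: (models_distinct coxWS m_st m_tu m_su omegaE alpha_lin).
Qed.
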